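(* Let $X$ be a distribution on $\mathbb{R}^d$ with mean $\mu_X$, let $S\subset\mathbb{R}^d$ be a $(6\epsilon,\delta)$-stable set with respect to $X$, and let $T$ be an $\epsilon$-corrupted version of $S$. Let $\lambda\ge0$. Suppose that for any $T'\subseteq T$ with $|T'\cap S|\ge(1-6\epsilon)|S|$ for which $\mathbf{Cov}[T']$ has an eigenvalue larger than $1+\lambda$, there is an efficient algorithm that computes a non-zero function $f:T'\to\mathbb{R}_{+}$ such that $\sum_{x\in T'}f(x)\ge 2\sum_{x\in T'\cap S}f(x)$. Then there exists a polynomial-time randomized algorithm that computes a vector $\widehat{\mu}$ which, with probability at least $2/3$, satisfies $\|\widehat{\mu}-\mu_X\|_2=O(\delta+\sqrt{\epsilon\lambda})$.
   Context: For $0<\epsilon'<1/2$ and $\delta\ge\epsilon'$, a finite (multi)set $S\subset\mathbb{R}^d$ is $(\epsilon',\delta)$-stable with respect to $X$ if for every unit vector $v$ and every $S'\subseteq S$ with $|S'|\ge(1-\epsilon')|S|$: (1) $\left|\frac{1}{|S'|}\sum_{x\in S'} v\cdot(x-\mu_X)\right|\le\delta$, and (2) $\left|\frac{1}{|S'|}\sum_{x\in S'}(v\cdot(x-\mu_X))^2-1\right|\le\delta^2/\epsilon'$ (here $\epsilon'=6\epsilon$). A multiset $T$ is an $\epsilon$-corrupted version of $S$ if it is obtained from $S$ by replacing at most $\epsilon|S|$ of its points by arbitrary points; $T\cap S$ denotes the points of $T$ that are original (unreplaced) points of $S$. $\mathbf{Cov}[T']$ is the covariance of the uniform distribution on $T'$.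 $O(\cdot)$ hides a universal constant. *)

(* Defs.v *)
From HB Require Import structures.
From mathcomp Require Import all_boot all_order all_algebra.
From mathcomp Require Import all_classical all_reals all_analysis.
Set Implicit Arguments.
Unset Strict Implicit.
Unset Printing Implicit Defensive.
Import Order.TTheory GRing.Theory Num.Theory.
Local Open Scope ring_scope.

(** * Vectors of R^d *)

(* The norm that MathComp-Analysis puts on ['rV[R]_d] is the sup norm, hence
   the explicit Euclidean one. *)
Definition dot (R : realType) (d : nat) (u v : 'rV[R]_d) : R :=
  \sum_(j < d) u 0 j * v 0 j.

Definition l2norm (R : realType) (d : nat) (u : 'rV[R]_d) : R :=
  Num.sqrt (dot u u).

(** * Distributions and multisets

   A multiset of [n] points is a family [S : 'I_n -> 'rV[R]_d]; its
   sub-multisets are index sets [{set 'I_n}]. *)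

(* [d.-tuple (measurableTypeR R)] is R^d with its Borel sigma-algebra. *)
Definition has_mean (R : realType) (d : nat)
    (X : probability (d.-tuple (measurableTypeR R)) R) (mu : 'rV[R]_d) : Prop :=
  forall j : 'I_d,
    X.-integrable setT (fun x => (tnth x j)%:E) /\
    (\int[X]_x (tnth x j)%:E = (mu 0 j)%:E)%E.

(* S is (e, delta)-stable with respect to a distribution of mean mu. *)
Definition stable (R : realType) (d n : nat) (e delta : R) (mu : 'rV[R]_d)
    (S : 'I_n -> 'rV[R]_d) : Prop :=
  forall (v : 'rV[R]_d) (S' : {set 'I_n}),
    l2norm v = 1 -> (1 - e) * n%:R <= #|S'|%:R ->
    `| #|S'|%:R^-1 * \sum_(i in S') dot v (S i - mu) | <= delta /\
    `| #|S'|%:R^-1 * (\sum_(i in S') dot v (S i - mu) ^+ 2) - 1 |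
      <= delta ^+ 2 / e.

(* T is an eps-corrupted version of S whose original points are those with
   index in O, so that the intersection of T' and S is [T' :&: O].  Aligning
   the indices of S and T is no restriction: stability does not depend on the
   order of S, so T can still be listed in any order. *)
Definition corrupted (R : realType) (d n : nat) (eps : R)
    (S T : 'I_n -> 'rV[R]_d) (O : {set 'I_n}) : Prop :=
  (forall i, i \in O -> T i = S i) /\ #|~: O|%:R <= eps * n%:R.

Definition mean (R : realType) (d n : nat) (T : 'I_n -> 'rV[R]_d)
    (T' : {set 'I_n}) : 'rV[R]_d :=
  #|T'|%:R^-1 *: \sum_(i in T') T i.

Definition Cov (R : realType) (d n : nat) (T : 'I_n -> 'rV[R]_d)
    (T' : {set 'I_n}) : 'M[R]_d :=
  #|T'|%:R^-1 *: \sum_(i in T') (T i - mean T T')^T *m (T i - mean T T').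

(** * Algorithms

   Points of R^d call for exact real arithmetic, so an algorithm is a program
   of a small real-RAM language: WHILE programs over binary trees (as in
   Jones, "Computability and Complexity from a Programming Perspective") whose
   leaves may hold real numbers.  Each elementary operation has unit cost,
   pairs being pointers to immutable cells.  Programs are finite syntax with
   no real constant but 0 and 1, hence uniform in the input and its size. *)

Inductive value (R : Type) : Type :=
| VNil : value R
| VNum : R -> value R
| VPair : value R -> value R -> value R.
Arguments VNil {R}.

Inductive prim : Set :=
| OpId | OpFst | OpSnd | OpNil | OpZero | OpOne
| OpAdd | OpSub | OpMul | OpDiv | OpPos | OpIsNum | OpIsPair.

Inductive prog : Set :=
| Prim of prim
| Seq of prog & prog
| Fork of prog & prog
| If of prog & prog & prog
| While of prog & prog.

(* [VNil] is false, every other value is true. *)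
Definition truthy (R : Type) (x : value R) : bool :=
  if x is VNil then false else true.

Definition vbool (R : Type) (b : bool) : value R :=
  if b then VPair VNil VNil else VNil.

Definition arith (R : Type) (f : R -> R -> R) (x : value R) : value R :=
  if x is VPair (VNum a) (VNum b) then VNum (f a b) else VNil.

(* Ill-typed operations return [VNil]; division by 0 returns 0. *)
Definition prim_eval (R : realType) (o : prim) (x : value R) : value R :=
  match o with
  | OpId => x
  | OpFst => if x is VPair a _ then a else VNil
  | OpSnd => if x is VPair _ b then b else VNil
  | OpNil => VNil
  | OpZero => VNum 0
  | OpOne => VNum 1
  | OpAdd => arith (fun a b => a + b) x
  | OpSub => arith (fun a b => a - b) x
  | OpMul => arith (fun a b => a * b) x
  | OpDiv => arith (fun a b => a / b) x
  | OpPos => vbool R (if x is VNum a then 0 < a else false)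
  | OpIsNum => vbool R (if x is VNum _ then true else false)
  | OpIsPair => vbool R (if x is VPair _ _ then true else false)
  end.

(* [exec p x y t]: on input [x], [p] halts with output [y] after [t] steps. *)
Inductive exec (R : realType) : prog -> value R -> value R -> nat -> Prop :=
| ExecPrim o x : exec (Prim o) x (prim_eval o x) 1
| ExecSeq p q x y z s t :
    exec p x y s -> exec q y z t -> exec (Seq p q) x z (s + t).+1
| ExecFork p q x y z s t :
    exec p x y s -> exec q x z t -> exec (Fork p q) x (VPair y z) (s + t).+1
| ExecIf b p q x w y s t :
    exec b x w s -> exec (if truthy w then p else q) x y t ->
    exec (If b p q) x y (s + t).+1
| ExecWhileStop b p x w s :
    exec b x w s -> ~~ truthy w -> exec (While b p) x x s.+1
| ExecWhileStep b p x w y z s t u :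
    exec b x w s -> truthy w -> exec p x y t -> exec (While b p) y z u ->
    exec (While b p) x z (s + t + u).+1.

Definition outputs_within (R : realType) (p : prog) (x y : value R) (m : nat) :=
  exists2 t : nat, exec p x y t & (t <= m)%N.

Definition halts_within (R : realType) (p : prog) (x : value R) (m : nat) :=
  exists y : value R, outputs_within p x y m.

Fixpoint vsize (R : Type) (x : value R) : nat :=
  if x is VPair a b then (vsize a + vsize b).+1 else 1%N.

Fixpoint enc_seq (R : Type) (s : seq (value R)) : value R :=
  if s is x :: s' then VPair x (enc_seq s') else VNil.

Definition enc_nums (R : Type) (s : seq R) : value R :=
  enc_seq [seq VNum a | a <- s].

Definition enc_vec (R : realType) (d : nat) (u : 'rV[R]_d) : value R :=
  enc_nums [seq u 0 j | j <- enum 'I_d].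

Definition enc_bits (R : realType) (r : seq bool) : value R :=
  enc_nums [seq (nat_of_bool b)%:R : R | b <- r].

(* The list [par] stands for whatever else an algorithm is told about the
   instance, e.g. eps and delta. *)
Definition enc_input (R : realType) (par : seq R) (lam : R) (d : nat)
    (T : seq 'rV[R]_d) : value R :=
  VPair (enc_nums par) (VPair (VNum lam) (enc_seq [seq enc_vec u | u <- T])).

(* Since sizes are positive, every polynomial is dominated by some
   [polybound c k]. *)
Definition polybound (c k s : nat) : nat := (c * s ^ k)%N.

(* [F], run for time [polybound c k], is a filter for the corrupted sample T
   with original points O: its output for T' lists the values of f on T'. *)
Definition good_filter (R : realType) (F : prog) (c k : nat) (par : seq R)
    (lam eps : R) (d n : nat) (T : 'I_n -> 'rV[R]_d) (O : {set 'I_n}) : Prop :=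
  forall T' : {set 'I_n},
    (1 - 6 * eps) * n%:R <= #|T' :&: O|%:R ->
    (exists2 a : R, eigenvalue (Cov T T') a & 1 + lam < a) ->
    let x := enc_input par lam [seq T i | i in T'] in
    exists f : 'I_n -> R,
      [/\ outputs_within F x (enc_nums [seq f i | i in T'])
           (polybound c k (vsize x)),
          forall i, i \in T' -> 0 <= f i,
          exists2 i, i \in T' & f i != 0
        & 2 * (\sum_(i in T' :&: O) f i) <= \sum_(i in T') f i].

(* A randomized algorithm receives, along with its input [x] of size s,
   [polybound cr kr s] fair coin flips; it runs in time [polybound c k s]
   whatever they are. *)
Definition rand_input (R : realType) (r : seq bool) (x : value R) : value R :=
  VPair (enc_bits R r) x.

Definition rand_poly_time (R : realType) (A : prog) (cr kr c k : nat) : Prop :=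
  forall (par : seq R) (lam : R) (d : nat) (T : seq 'rV[R]_d),
    let x := enc_input par lam T in
    forall r : (polybound cr kr (vsize x)).-tuple bool,
      halts_within A (rand_input r x) (polybound c k (vsize x)).

(* Probability of E for m independent fair coin flips. *)
Definition coin_prob (R : realType) (m : nat) (E : m.-tuple bool -> Prop) : R :=
  #|[set r : m.-tuple bool | `[< E r >] ]|%:R / (2 ^ m)%:R.

(* Main.v *)
Require Import Defs.
From HB Require Import structures.
From mathcomp Require Import all_boot all_order all_algebra.
From mathcomp Require Import all_classical all_reals all_analysis.
From mathcomp Require Import zify ring lra.
Set Implicit Arguments.
Unset Strict Implicit.
Unset Printing Implicit Defensive.
Import Order.TTheory GRing.Theory Num.Theory numFieldNormedType.Exports.
Local Open Scope ring_scope.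

(* The algorithm repeats the following round as many times as there are points.
   If the covariance C of the remaining points passes a test ensuring
   C <= 1 + lam + 1/m, where m is their number, they are kept; otherwise C has
   an eigenvalue > 1 + lam, the filter is run, a random threshold u in [0, 1)
   is drawn, and every point with u * max f < f(x) is removed.  A point is
   removed with probability f(x) / max f up to 2^-2n, so the potential "good
   points removed + bad points remaining" is a supermartingale up to a
   negligible drift.  It starts at most at eps n and so stays below 5 eps n
   with probability at least 2/3.  Each round removes a maximiser of f, hence
   the test passes eventually.  Then the few remaining bad points are harmless:
   to move the mean by t they must contribute about t^2 / eps to the variance in
   the direction of the error, and by stability the good points alone already
   contribute almost 1.

   The filter may misbehave on illegitimate inputs, so it is run on a clock,
   for which the list of coins serves. *)

(** * Clocked simulation of programs *)

(** The language has only field operations and sign tests, so eigenvalues are out of reach. The test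
    decides instead, by exact rank-one updates, whether ((1 + lam) m + 1) |v|^2 - sum (y.v)^2 is a
    positive definite form in v, y ranging over the centred points. The added 1 makes both answers
    usable: failure, even with equality, exhibits an eigenvalue strictly above 1 + lam, and the
    slack that success leaves is absorbed because the number of bad points is an integer.

    One threshold per round serves all points: only expectations enter the potential, and a
    maximiser always goes since u < 1. Rounding u to 2n bits creates a drift that must be small
    against 5 eps n, however small eps is. On an uncorrupted sample no non-zero f meets the
    specification of the filter, so eps n >= 1 whenever a round does anything.

    The level 5 eps n is what stability allows: together with the at most eps n replaced points, at
    most 6 eps n points of S are missing. Reaching it from eps n has probability at most 1/5, plus
    1/20 for the drift. *)

Lemma exec_det (R : realType) (p : prog) (x y : value R) t :
  exec p x y t -> forall y' t', exec p x y' t' -> y' = y.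
Proof.
elim=> {p x y t}; intros;
  match goal with E : exec _ _ ?y _ |- ?y = _ => inversion E; subst end;
  repeat match goal with
  | IH : (forall y t, exec ?p ?x y t -> y = ?z), H : exec ?p ?x ?y' _ |- _ =>
      have := IH _ _ H; clear IH H; intro; subst
  end; try done;
  by match goal with H : is_true (truthy ?b), H' : is_true (~~ truthy ?b) |- _ =>
    rewrite H in H' end.
Qed.

Lemma within_le (R : realType) p (x y : value R) s t :
  outputs_within p x y s -> (s <= t)%N -> outputs_within p x y t.
Proof. by case=> u E us st; exists u => //; apply: leq_trans us st. Qed.

Lemma within_prim (R : realType) o (x : value R) :
  outputs_within (Prim o) x (prim_eval o x) 1.
Proof. by exists 1%N => //; constructor. Qed.

Lemma within_seq (R : realType) p q (x y z : value R) s t :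
  outputs_within p x y s -> outputs_within q y z t ->
  outputs_within (Seq p q) x z (s + t).+1.
Proof.
case=> u E us [v E' vt]; exists (u + v).+1; first exact: ExecSeq E E'.
by rewrite ltnS leq_add.
Qed.

Lemma within_fork (R : realType) p q (x y z : value R) s t :
  outputs_within p x y s -> outputs_within q x z t ->
  outputs_within (Fork p q) x (VPair y z) (s + t).+1.
Proof.
case=> u E us [v E' vt]; exists (u + v).+1; first exact: ExecFork E E'.
by rewrite ltnS leq_add.
Qed.

Lemma within_if (R : realType) b p q (x w y : value R) s t :
  outputs_within b x w s ->
  outputs_within (if truthy w then p else q) x y t ->
  outputs_within (If b p q) x y (s + t).+1.
Proof.
case=> u E us [v E' vt]; exists (u + v).+1; first exact: ExecIf E E'.
by rewrite ltnS leq_add.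
Qed.

Lemma within_while_stop (R : realType) b p (x w : value R) s :
  outputs_within b x w s -> ~~ truthy w ->
  outputs_within (While b p) x x s.+1.
Proof. by case=> u E us w0; exists u.+1 => //; exact: ExecWhileStop E w0. Qed.

Lemma within_while_step (R : realType) b p (x w y z : value R) s t u :
  outputs_within b x w s -> truthy w -> outputs_within p x y t ->
  outputs_within (While b p) y z u ->
  outputs_within (While b p) x z (s + t + u).+1.
Proof.
case=> s' Eb ss w1 [t' Ep tt] [u' Ew uu].
exists (s' + t' + u').+1; first exact: ExecWhileStep Eb w1 Ep Ew.
by rewrite ltnS !leq_add.
Qed.

Definition on_snd (p : prog) : prog := Seq (Prim OpSnd) p.
Definition pfst := Prim OpFst.
Definition psnd := Prim OpSnd.

(* The input and the output are paired with a list used as a clock: each loop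
   iteration consumes one item, and no loop continues on an empty clock. *)
Fixpoint clocked (p : prog) : prog :=
  let start q := Seq (Fork pfst (on_snd psnd)) (clocked q) in
  match p with
  | Prim o => Fork (Seq pfst (Prim o)) psnd
  | Seq p q => Seq (clocked p) (clocked q)
  | Fork p q =>
      Seq (Fork pfst (clocked p))
        (Seq (Fork (on_snd pfst) (start q))
           (Fork (Fork pfst (on_snd pfst)) (on_snd psnd)))
  | If b p q => Seq (Fork pfst (clocked b)) (If (on_snd pfst) (start p) (start q))
  | While b p =>
      Seq (Fork pfst (clocked b))
        (Seq (While (If (on_snd pfst) (on_snd psnd) (Prim OpNil))
                (Seq (Fork pfst (on_snd (on_snd psnd)))
                   (Seq (clocked p) (Fork pfst (clocked b)))))
           (Fork pfst (on_snd psnd)))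
  end.

Ltac straight := repeat first
  [ exact: within_prim | eapply within_seq | eapply within_fork ].


(** The time is charged to the items consumed, not to the length of the clock: consumptions of
    successive pieces add up, so the bound stays linear through compositions and nested loops. *)
Lemma clocked_halts (R : realType) (p : prog) :
  exists a : nat, forall (x : value R) (l : seq (value R)),
  exists (y : value R) (l' : seq (value R)), (size l' <= size l)%N /\
    outputs_within (clocked p) (VPair x (enc_seq l)) (VPair y (enc_seq l'))
      (a * (size l - size l').+1).
Proof.
have step q aq : (forall (x : value R) (l : seq (value R)),
    exists (y : value R) (l' : seq (value R)), (size l' <= size l)%N /\
    outputs_within (clocked q) (VPair x (enc_seq l)) (VPair y (enc_seq l'))
      (aq * (size l - size l').+1)) ->
  forall x w l, exists (y : value R) (l' : seq (value R)), (size l' <= size l)%N /\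
    outputs_within (Seq (Fork pfst (on_snd psnd)) (clocked q))
      (VPair x (VPair w (enc_seq l))) (VPair y (enc_seq l'))
      (10 + aq * (size l - size l').+1).
  move=> H x w l; have [y [l' [le E]]] := H x l; exists y, l'; split=> //.
  eapply within_le; first by eapply within_seq; [straight | exact: E].
  by lia.
elim: p => [op|p [a Ha] q [b Hb]|p [a Ha] q [b Hb]|b [c Hc] p [a Ha] q [e He]|b [c Hc] p [a Ha]].
- exists 10%N; move=> x l; exists (prim_eval op x), l; split=> //.
  by eapply within_le; [straight | lia].
- exists (a + b + 1)%N; move=> x l.
  have [y [l1 [le1 E1]]] := Ha x l; have [z [l2 [le2 E2]]] := Hb y l1.
  exists z, l2; split; first by lia.
  by eapply within_le; [eapply within_seq; [exact: E1|exact: E2]|nia].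
- exists (a + b + 40)%N; move=> x l.
  have [y [l1 [le1 E1]]] := Ha x l; have [z [l2 [le2 E2]]] := step _ _ Hb x y l1.
  exists (VPair y z), l2; split; first by lia.
  eapply within_le.
    eapply within_seq; first by eapply within_fork; [straight|exact: E1].
    eapply within_seq; first by eapply within_fork; [straight|exact: E2].
    by straight.
  by nia.
- exists (a + c + e + 40)%N; move=> x l.
  have [w [l1 [le1 E1]]] := Hc x l.
  have [y [l2 [le2 E2]]] : exists (y : value R) (l2 : seq (value R)), (size l2 <= size l1)%N /\
    outputs_within (if truthy w then Seq (Fork pfst (on_snd psnd)) (clocked p)
      else Seq (Fork pfst (on_snd psnd)) (clocked q))
      (VPair x (VPair w (enc_seq l1))) (VPair y (enc_seq l2))
      (10 + (a + e) * (size l1 - size l2).+1).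
    case: (truthy w).
      have [y [l2 [le2 E2]]] := step _ _ Ha x w l1; exists y, l2; split=> //.
      by apply: within_le E2 _; nia.
    have [y [l2 [le2 E2]]] := step _ _ He x w l1; exists y, l2; split=> //.
    by apply: within_le E2 _; nia.
  exists y, l2; split; first by lia.
  eapply within_le.
    eapply within_seq; first by eapply within_fork; [straight|exact: E1].
    by eapply within_if; [straight|exact: E2].
  by nia.
- set W := While (If (on_snd pfst) (on_snd psnd) (Prim OpNil))
                (Seq (Fork pfst (on_snd (on_snd psnd)))
                   (Seq (clocked p) (Fork pfst (clocked b)))).
  (* Each iteration removes one item before running [clocked p], and this item pays for the fixed
     overhead of the iteration. *)
  have loop m : forall x w (l : seq (value R)), (size l <= m)%N ->
    exists (y w' : value R) (l' : seq (value R)), (size l' <= size l)%N /\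
      outputs_within W (VPair x (VPair w (enc_seq l))) (VPair y (VPair w' (enc_seq l')))
      (40 + (a + c + 80) * (size l - size l')).
    elim: m => [|m IHm] x w l sl.
      move: sl; rewrite leqn0 => /nilP ->.
      exists x, w, [::]; split=> //.
      eapply within_le; first eapply within_while_stop.
      + eapply within_if; first by straight.
        (* The clock is empty, so the guard evaluates to [VNil] in both branches. *)
        apply: (@within_le _ _ _ VNil 3); last by [].
        by case: w => *; (eapply within_le; [by straight|by []]).
      + by case: w.
      + by lia.
    case: l sl => [|v l] sl.
      by have [y [w' [l' [le E]]]] := IHm x w [::] isT; exists y, w', l'.
    have [w0|w1] := boolP (~~ truthy w).
      exists x, w, (v :: l); split=> //.
      eapply within_le; first eapply within_while_stop.
      + by eapply within_if; [straight | rewrite /= (negbTE w0); straight].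
      + by [].
      + by lia.
    have [x1 [l1 [le1 E1]]] := Ha x l; have [w2 [l2 [le2 E2]]] := Hc x1 l1.
    have [|y [w' [l' [le E]]]] := IHm x1 w2 l2; first by move: sl => /=; lia.
    exists y, w', l'; split; first by move=> /=; lia.
    eapply within_le.
      eapply within_while_step.
      + by eapply within_if; [straight | rewrite /= (negbNE w1); straight].
      + by [].
      + eapply within_seq; first by straight.
        eapply within_seq; first exact: E1.
        by eapply within_fork; [straight | exact: E2].
      + exact: E.
    by rewrite [size (_ :: _)]/=; nia.
  exists (a + c + 200)%N; move=> x l.
  have [w [l1 [le1 E1]]] := Hc x l.
  have [y [w' [l2 [le2 E2]]]] := loop (size l1) x w l1 (leqnn _).
  exists y, l2; split; first by lia.
  eapply within_le.
    eapply within_seq; first by eapply within_fork; [straight|exact: E1].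
    eapply within_seq; first exact: E2.
    by straight.
  by nia.
Qed.

Lemma exec_seq_inv (R : realType) p q (x z : value R) t :
  exec (Seq p q) x z t -> exists y s u, exec p x y s /\ exec q y z u.
Proof. by move=> E; inversion E; subst; do 3 eexists; split; eassumption. Qed.

Lemma within_exec (R : realType) p (x y : value R) t :
  exec p x y t -> outputs_within p x y t.
Proof. by exists t. Qed.

(** Each loop iteration takes at least one step, so at most t items are consumed and a clock of
    length t never interrupts the run. *)
Lemma clocked_exec (R : realType) (p : prog) (x y : value R) t :
  exec p x y t -> forall l : seq (value R), (t <= size l)%N ->
  exists (l' : seq (value R)) s, (size l <= size l' + t)%N /\
    outputs_within (clocked p) (VPair x (enc_seq l)) (VPair y (enc_seq l')) s.
Proof.
elim=> {p x y t}.
- by move=> o x l _; exists l; eexists; split; [lia|straight].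
- move=> p q x y z s t _ IHp _ IHq l tl.
  have [|l1 [u1 [le1 E1]]] := IHp l; first by lia.
  have [|l2 [u2 [le2 E2]]] := IHq l1; first by lia.
  by exists l2; eexists; split; [lia | eapply within_seq; [exact: E1|exact: E2]].
- move=> p q x y z s t _ IHp _ IHq l tl.
  have [|l1 [u1 [le1 E1]]] := IHp l; first by lia.
  have [|l2 [u2 [le2 E2]]] := IHq l1; first by lia.
  exists l2; eexists; split; first by lia.
  eapply within_seq; first by eapply within_fork; [straight|exact: E1].
  eapply within_seq.
    eapply within_fork; first by straight.
    by eapply within_seq; [straight|exact: E2].
  by straight.
- move=> b p q x w y s t _ IHb _ IHp l tl.
  have [|l1 [u1 [le1 E1]]] := IHb l; first by lia.
  have [|l2 [u2 [le2 E2]]] := IHp l1; first by lia.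
  exists l2; eexists; split; first by lia.
  eapply within_seq; first by eapply within_fork; [straight|exact: E1].
  eapply within_if; first by straight.
  apply: (@within_le _ _ _ _ (10 + u2)%N) (leqnn _).
  by case: (truthy w) E2 => /= E2;
    (eapply within_le; [by eapply within_seq; [straight|exact: E2]|lia]).
- move=> b p x w s _ IHb w0 l tl.
  have [|l1 [u1 [le1 E1]]] := IHb l; first by lia.
  exists l1; eexists; split; first by lia.
  eapply within_seq; first by eapply within_fork; [straight|exact: E1].
  eapply within_seq.
    apply: (@within_while_stop _ _ _ _ VNil 8); last by [].
    by eapply within_le; [eapply within_if; [straight | rewrite /= (negbTE w0); straight]|].
  by straight.
- move=> b p x w y z s t u _ IHb w1 _ IHp _ IHw l tl.
  have [|l1 [u1 [le1 E1]]] := IHb l; first by lia.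
  (* The whole loop takes more steps than its first guard, so the guard cannot have exhausted the
     clock. *)
  case: l1 le1 E1 => [|v l1] le1 E1; first by move: le1 => /=; lia.
  have [|l2 [u2 [le2 E2]]] := IHp l1; first by move: le1 => /=; lia.
  have [|l3 [u3 [le3 [u' E3 _]]]] := IHw l2; first by move: le1 => /=; lia.
  (* The simulation of the remaining loop is cut into its initial guard [F1], its inner loop [F2]
     and its epilogue [F3]; that guard becomes the end of the present body. *)
  have [x1 [s1 [v1 [F1 /exec_seq_inv[x2 [s2 [v2 [F2 F3]]]]]]]] := exec_seq_inv E3.
  exists l3; eexists; split; first by move: le1 => /=; lia.
  eapply within_seq; first by eapply within_fork; [straight|exact: E1].
  eapply within_seq; last exact: within_exec F3.
  eapply within_while_step; last exact: within_exec F2.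
  + by eapply within_if; [straight | rewrite /= w1; straight].
  + by [].
  + eapply within_seq; first by straight.
    eapply within_seq; first exact: E2.
    exact: within_exec F1.
Qed.

(** Choice makes the output of the simulation a total function [g], also where [p] diverges, so that
    the algorithm can be described by equations. *)
Lemma clocked_fun (R : realType) (p : prog) :
  exists (a : nat) (g : value R -> seq (value R) -> value R), forall x l,
    outputs_within (Seq (clocked p) pfst) (VPair x (enc_seq l)) (g x l)
      (a * (size l).+1) /\
    forall y t, exec p x y t -> (t <= size l)%N -> g x l = y.
Proof.
have [a Ha] := clocked_halts R p.
pose P (xl : value R * seq (value R)) y := exists l',
  (size l' <= size xl.2)%N /\
    outputs_within (clocked p) (VPair xl.1 (enc_seq xl.2)) (VPair y (enc_seq l'))
      (a * (size xl.2 - size l').+1).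
have [g gP] : {g & forall xl, P xl (g xl)}.
  apply: choice => -[x l]; have [y [l' H]] := Ha x l.
  by exists y, l'.
exists (a + 2)%N, (fun x l => g (x, l)) => x l.
have [l' [le E]] := gP (x, l); split.
  by eapply within_le; [eapply within_seq; [exact: E|straight]|move: le => /=; nia].
(* This run comes without a useful time bound; determinism identifies its output with the one chosen
   by [g]. *)
move=> y t Ey tl; have [l2 [s [_ [s' E' _]]]] := clocked_exec Ey tl.
by case: E => s0 /exec_det /(_ _ _ E') [->].
Qed.

(** * Expressions computable in polynomial time *)

(** The successor keeps the base positive, so that raising the exponent only weakens the bound. *)
Definition poly_time (I : Type) (D : I -> Prop) (sz t : I -> nat) : Prop :=
  exists c k, forall i, D i -> (t i <= c * (sz i).+1 ^ k)%N.

Lemma poly_time_cst (I : Type) (D : I -> Prop) (sz : I -> nat) m :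
  poly_time D sz (fun=> m).
Proof. by exists m, 0%N => i _; rewrite expn0 muln1. Qed.

Lemma poly_time_size (I : Type) (D : I -> Prop) (sz : I -> nat) :
  poly_time D sz sz.
Proof. by exists 1%N, 1%N => i _; rewrite expn1 mul1n. Qed.

Lemma poly_time_le (I : Type) (D : I -> Prop) (sz t t' : I -> nat) :
  poly_time D sz t' -> (forall i, D i -> (t i <= t' i)%N) -> poly_time D sz t.
Proof.
by case=> c [k H] le; exists c, k => i Di; apply: leq_trans (le i Di) (H i Di).
Qed.

Lemma poly_time_add (I : Type) (D : I -> Prop) (sz t t' : I -> nat) :
  poly_time D sz t -> poly_time D sz t' ->
  poly_time D sz (fun i => t i + t' i)%N.
Proof.
case=> c [k H] [c' [k' H']]; exists (c + c')%N, (k + k')%N => i Di.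
rewrite mulnDl leq_add //.
  by apply: leq_trans (H i Di) _; rewrite leq_mul2l leq_pexp2l ?leq_addr ?orbT.
by apply: leq_trans (H' i Di) _; rewrite leq_mul2l leq_pexp2l ?leq_addl ?orbT.
Qed.

Lemma poly_time_mul (I : Type) (D : I -> Prop) (sz t t' : I -> nat) :
  poly_time D sz t -> poly_time D sz t' ->
  poly_time D sz (fun i => t i * t' i)%N.
Proof.
case=> c [k H] [c' [k' H']]; exists (c * c')%N, (k + k')%N => i Di.
by rewrite expnD mulnACA leq_mul ?H ?H'.
Qed.

(* A single program maps the encoding [a i] to [b i] for every index [i] in
   [D], in time polynomial in the abstract measure [sz i].  Expressions of the
   algorithm are described by the function [b] of a fixed environment [a]. *)
Definition computes (R : realType) (I : Type) (D : I -> Prop) (sz : I -> nat)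
    (a b : I -> value R) : Prop :=
  exists (p : prog) (t : I -> nat), poly_time D sz t /\
    forall i, D i -> outputs_within p (a i) (b i) (t i).

Lemma computes_prim (R : realType) (I : Type) D sz (a b : I -> value R) o :
  computes D sz a b -> computes D sz a (fun i => prim_eval o (b i)).
Proof.
case=> p [t [tP H]]; exists (Seq p (Prim o)), (fun i => t i + 2)%N; split.
  by apply: poly_time_add => //; exact: poly_time_cst.
move=> i Di; eapply within_le; first by eapply within_seq; [exact: H|straight].
by lia.
Qed.

Lemma computes_id (R : realType) (I : Type) D sz (a : I -> value R) :
  computes D sz a a.
Proof.
exists (Prim OpId), (fun=> 1%N); split; first exact: poly_time_cst.
by move=> i _; exact: within_prim.
Qed.

Lemma computes_comp (R : realType) (I : Type) D sz (a b e : I -> value R) :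
  computes D sz a b -> computes D sz b e -> computes D sz a e.
Proof.
case=> p [t [tP H]] [q [u [uP H']]].
exists (Seq p q), (fun i => t i + u i + 1)%N; split.
  by do !apply: poly_time_add => //; exact: poly_time_cst.
by move=> i Di; eapply within_le; [eapply within_seq; eauto|lia].
Qed.

Lemma computes_ext (R : realType) (I : Type) D sz (a b b' : I -> value R) :
  (forall i, D i -> b i = b' i) -> computes D sz a b -> computes D sz a b'.
Proof.
by move=> e [p [t [tP H]]]; exists p, t; split=> // i Di; rewrite -e //; auto.
Qed.

Lemma computes_sub (R : realType) (I : Type) (D D' : I -> Prop) sz
    (a b : I -> value R) :
  (forall i, D' i -> D i) -> computes D sz a b -> computes D' sz a b.
Proof.
move=> s [p [t [[c [k tP]] H]]]; exists p, t; split; last by auto.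
by exists c, k; auto.
Qed.

Lemma computes_reindex (R : realType) (I J : Type) (f : J -> I)
    (D : I -> Prop) (D' : J -> Prop) sz (a b : I -> value R) :
  (forall j, D' j -> D (f j)) -> computes D sz a b ->
  computes D' (sz \o f) (a \o f) (b \o f).
Proof.
move=> s [p [t [[c [k tP]] H]]]; exists p, (t \o f); split.
  by exists c, k => j Dj; apply: tP; auto.
by move=> j Dj; apply: H; auto.
Qed.

Lemma computes_pair (R : realType) (I : Type) D sz (a b b' : I -> value R) :
  computes D sz a b -> computes D sz a b' ->
  computes D sz a (fun i => VPair (b i) (b' i)).
Proof.
case=> p [t [tP H]] [q [u [uP H']]].
exists (Fork p q), (fun i => t i + u i + 1)%N; split.
  by do !apply: poly_time_add => //; exact: poly_time_cst.
by move=> i Di; eapply within_le; [eapply within_fork; eauto|lia].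
Qed.

(** Each branch has to be computable only where it is taken, so it may rely on the outcome of the
    test. *)
Lemma computes_if (R : realType) (I : Type) D sz (a b b' : I -> value R)
    (c : I -> bool) :
  computes D sz a (fun i => vbool R (c i)) ->
  computes (fun i => D i /\ c i) sz a b ->
  computes (fun i => D i /\ ~~ c i) sz a b' ->
  computes D sz a (fun i => if c i then b i else b' i).
Proof.
case=> p [t [tP H]] [q [u [[cu [ku uP]] H']]] [r [w [[cw [kw wP]] H'']]].
exists (If p q r), (fun i => t i + (if c i then u i else w i) + 1)%N; split.
  apply: poly_time_add; last exact: poly_time_cst.
  apply: poly_time_add => //.
  apply: (@poly_time_le _ _ _ _ (fun i =>
    cu * (sz i).+1 ^ ku + cw * (sz i).+1 ^ kw)%N).
    by apply: poly_time_add; [exists cu, ku|exists cw, kw].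
  move=> i Di; case: ifPn => ci.
    by apply: leq_trans (uP i _) (leq_addr _ _).
  by apply: leq_trans (wP i _) (leq_addl _ _).
move=> i Di; eapply within_le; first eapply within_if.
- exact: H.
- by instantiate (1 := if c i then u i else w i);
    case ci: (c i); [apply: H' | apply: H'']; rewrite ?ci.
- by lia.
Qed.

(* The loop body runs on [VPair env (VPair state item)]; its index [(i, k)]
   records the number [k] of items already treated. *)
Lemma computes_fold (R : realType) (I : Type) D sz (a : I -> value R)
    (l : I -> seq (value R)) (s : I -> nat -> value R) :
  (forall i, D i -> (size (l i) <= sz i)%N) ->
  computes D sz a (fun i => enc_seq (l i)) ->
  computes D sz a (fun i => s i 0%N) ->
  computes (fun j : I * nat => D j.1 /\ (j.2 < size (l j.1))%N) (sz \o fst)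
    (fun j => VPair (a j.1) (VPair (s j.1 j.2) (nth VNil (l j.1) j.2)))
    (fun j => s j.1 j.2.+1) ->
  computes D sz a (fun i => s i (size (l i))).
Proof.
move=> lsz [pl [tl [tlP Hl]]] [ps [ts [tsP Hs]]] [q [tq [[c [k tqP]] Hq]]].
pose B i := (c * (sz i).+1 ^ k)%N.
pose W := While (on_snd psnd) (Fork pfst (Fork
  (Seq (Fork pfst (Fork (on_snd pfst) (on_snd (on_snd pfst)))) q)
  (on_snd (on_snd psnd)))).
exists (Seq (Fork (Prim OpId) (Fork ps pl)) (Seq W (on_snd pfst))),
  (fun i => tl i + ts i + sz i * (B i + 40) + 40)%N; split.
  apply: poly_time_add; last exact: poly_time_cst.
  apply: poly_time_add; first exact: poly_time_add.
  apply: poly_time_mul; first exact: poly_time_size.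
  by apply: poly_time_add; [exists c, k|exact: poly_time_cst].
move=> i Di.
(* The bound [B i] on one iteration depends on the index alone and not on the state reached, so the
   iterations do not compound. *)
have loop m : forall n, (n + m = size (l i))%N ->
    outputs_within W (VPair (a i) (VPair (s i n) (enc_seq (drop n (l i)))))
      (VPair (a i) (VPair (s i (size (l i))) VNil)) (m * (B i + 40) + 10).
  elim: m => [|m IHm] n nm.
    rewrite addn0 in nm; rewrite nm drop_size.
    by eapply within_le; [eapply within_while_stop; [straight|]|].
  have n_lt : (n < size (l i))%N by lia.
  rewrite (drop_nth VNil n_lt) /=.
  eapply within_le; first eapply within_while_step.
  + by straight.
  + by [].
  + eapply within_fork; first by straight.
    eapply within_fork; last by straight.
    by eapply within_seq; [straight | exact: (Hq (i, n))].
  + by apply: (IHm n.+1); lia.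
  have := tqP (i, n) (conj Di n_lt); rewrite /= -/(B i); nia.
have loop0 := loop (size (l i)) 0%N (add0n _); rewrite drop0 in loop0.
eapply within_le.
  eapply within_seq.
    by eapply within_fork; [straight|eapply within_fork; [exact: Hs|exact: Hl]].
  by eapply within_seq; [exact: loop0|straight].
by have := lsz i Di; nia.
Qed.

(** Whatever the environment computes stays available inside a loop, whose body receives the
    environment as its first component. *)
Lemma computes_env (R : realType) (I J : Type) (f : J -> I) (D : I -> Prop)
    (D' : J -> Prop) sz (a x : I -> value R) (w : J -> value R) :
  (forall j, D' j -> D (f j)) -> computes D sz a x ->
  computes D' (sz \o f) (fun j => VPair (a (f j)) (w j)) (fun j => x (f j)).
Proof.
move=> s H; apply: (@computes_comp _ _ _ _ _ (a \o f)).
  exact: (@computes_prim _ _ _ _ _ (fun j => VPair (a (f j)) (w j)) OpFst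
    (computes_id _ _ _)).
exact: computes_reindex H.
Qed.

Lemma computes_fst (R : realType) (I : Type) D sz (a b b' : I -> value R) :
  computes D sz a (fun i => VPair (b i) (b' i)) -> computes D sz a b.
Proof. exact: (@computes_prim _ _ _ _ _ _ OpFst). Qed.

Lemma computes_snd (R : realType) (I : Type) D sz (a b b' : I -> value R) :
  computes D sz a (fun i => VPair (b i) (b' i)) -> computes D sz a b'.
Proof. exact: (@computes_prim _ _ _ _ _ _ OpSnd). Qed.

Lemma computes_state (R : realType) (I : Type) D sz (a b b' : I -> value R) :
  computes D sz (fun i => VPair (a i) (VPair (b i) (b' i))) b.
Proof. exact/computes_fst/computes_snd/computes_id. Qed.

Lemma computes_item (R : realType) (I : Type) D sz (a b b' : I -> value R) :
  computes D sz (fun i => VPair (a i) (VPair (b i) (b' i))) b'.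
Proof. exact/computes_snd/computes_snd/computes_id. Qed.

Lemma computes_arith (R : realType) (I : Type) D sz (a : I -> value R) x y
    (f : R -> R -> R) o :
  (forall u v, prim_eval o (VPair (VNum u) (VNum v)) = VNum (f u v)) ->
  computes D sz a (fun i => VNum (x i)) ->
  computes D sz a (fun i => VNum (y i)) ->
  computes D sz a (fun i => VNum (f (x i) (y i))).
Proof.
move=> e Hx Hy; have := computes_prim o (computes_pair Hx Hy).
by apply: computes_ext => i _; exact: e.
Qed.

Lemma computes_add (R : realType) (I : Type) D sz (a : I -> value R) x y :
  computes D sz a (fun i => VNum (x i)) ->
  computes D sz a (fun i => VNum (y i)) ->
  computes D sz a (fun i => VNum (x i + y i)).
Proof. exact: (@computes_arith _ _ _ _ _ _ _ +%R OpAdd). Qed.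

Lemma computes_subr (R : realType) (I : Type) D sz (a : I -> value R) x y :
  computes D sz a (fun i => VNum (x i)) ->
  computes D sz a (fun i => VNum (y i)) ->
  computes D sz a (fun i => VNum (x i - y i)).
Proof. exact: (@computes_arith _ _ _ _ _ _ _ (fun u v => u - v) OpSub). Qed.

Lemma computes_mul (R : realType) (I : Type) D sz (a : I -> value R) x y :
  computes D sz a (fun i => VNum (x i)) ->
  computes D sz a (fun i => VNum (y i)) ->
  computes D sz a (fun i => VNum (x i * y i)).
Proof. exact: (@computes_arith _ _ _ _ _ _ _ *%R OpMul). Qed.

Lemma computes_div (R : realType) (I : Type) D sz (a : I -> value R) x y :
  computes D sz a (fun i => VNum (x i)) ->
  computes D sz a (fun i => VNum (y i)) ->
  computes D sz a (fun i => VNum (x i / y i)).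
Proof. exact: (@computes_arith _ _ _ _ _ _ _ (fun u v => u / v) OpDiv). Qed.

Lemma computes_nil (R : realType) (I : Type) D sz (a : I -> value R) :
  computes D sz a (fun=> VNil).
Proof. exact: (computes_prim OpNil (computes_id D sz a)). Qed.

Lemma computes_zero (R : realType) (I : Type) D sz (a : I -> value R) :
  computes D sz a (fun=> VNum 0).
Proof. exact: (computes_prim OpZero (computes_id D sz a)). Qed.

Lemma computes_one (R : realType) (I : Type) D sz (a : I -> value R) :
  computes D sz a (fun=> VNum 1).
Proof. exact: (computes_prim OpOne (computes_id D sz a)). Qed.

Lemma computes_and (R : realType) (I : Type) D sz (a : I -> value R) b c :
  computes D sz a (fun i => vbool R (b i)) ->
  computes D sz a (fun i => vbool R (c i)) ->
  computes D sz a (fun i => vbool R (b i && c i)).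
Proof.
move=> Hb Hc.
apply: (@computes_ext _ _ _ _ _ (fun i => if b i then vbool R (c i) else VNil)).
  by move=> i _; case: (b i).
apply: computes_if Hb _ (computes_nil _ _ _).
by apply: computes_sub Hc => i [].
Qed.

(** A loop can only push items at the head of a list, so the lists it builds come out reversed and
    have to be turned over. *)
Lemma computes_rev (R : realType) (I : Type) D sz (a : I -> value R)
    (l : I -> seq (value R)) :
  (forall i, D i -> (size (l i) <= sz i)%N) ->
  computes D sz a (fun i => enc_seq (l i)) ->
  computes D sz a (fun i => enc_seq (rev (l i))).
Proof.
move=> lsz Hl.
have := @computes_fold R I D sz a l (fun i k => enc_seq (rev (take k (l i)))) lsz Hl.
under [fun i : I => enc_seq (rev (take 0 (l i)))]eq_fun do rewrite take0.
under [X in _ -> _ -> computes _ _ _ X]eq_fun do rewrite take_size.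
apply; first exact: computes_nil.
apply: computes_ext (computes_pair (computes_item _ _ _ _ _) (computes_state _ _ _ _ _)).
by move=> [i k] [_ /= kl]; rewrite (take_nth VNil) // rev_rcons.
Qed.

Lemma computes_map (R : realType) (I : Type) D sz (a : I -> value R)
    (l : I -> seq (value R)) (h : I -> nat -> value R) :
  (forall i, D i -> (size (l i) <= sz i)%N) ->
  computes D sz a (fun i => enc_seq (l i)) ->
  computes (fun j : I * nat => D j.1 /\ (j.2 < size (l j.1))%N) (sz \o fst)
    (fun j => VPair (a j.1) (nth VNil (l j.1) j.2)) (fun j => h j.1 j.2) ->
  computes D sz a (fun i => enc_seq (mkseq (h i) (size (l i)))).
Proof.
move=> lsz Hl Hh.
suff : computes D sz a (fun i => enc_seq (rev (mkseq (h i) (size (l i))))).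
  move=> /computes_rev H; have := H _.
  under eq_fun do rewrite revK; apply.
  by move=> i Di; rewrite size_rev size_mkseq lsz.
apply: (@computes_fold R I D sz a l (fun i k => enc_seq (rev (mkseq (h i) k)))) => //.
  exact: computes_nil.
under [X in computes _ _ _ X]eq_fun do rewrite mkseqS rev_rcons /=.
apply: computes_pair; last exact: computes_state.
apply: computes_comp Hh; apply: computes_pair; last exact: computes_item.
exact/computes_fst/computes_id.
Qed.

Lemma computes_outer (R : realType) (I : Type) (D : I -> Prop)
    (P : I * nat -> Prop) sz (a x : I -> value R) (w : I * nat -> value R) :
  computes D sz a x ->
  computes (fun j => D j.1 /\ P j) (sz \o fst)
    (fun j => VPair (a j.1) (w j)) (fun j => x j.1).
Proof. by apply: (@computes_env _ _ _ fst) => j []. Qed.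

(** A variant of [computes_fold] in which the items, before encoding, have a type depending on the
    index, as vectors of varying dimension do. *)
Lemma computes_foldT (R : realType) (I : Type) D sz (a : I -> value R)
    (B : I -> Type) (x0 : forall i, B i) (enc : forall i, B i -> value R)
    (l : forall i, seq (B i)) (s : I -> nat -> value R) :
  (forall i, D i -> (size (l i) <= sz i)%N) ->
  computes D sz a (fun i => enc_seq [seq enc i x | x <- l i]) ->
  computes D sz a (fun i => s i 0%N) ->
  computes (fun j : I * nat => D j.1 /\ (j.2 < size (l j.1))%N) (sz \o fst)
    (fun j => VPair (a j.1)
      (VPair (s j.1 j.2) (enc j.1 (nth (x0 j.1) (l j.1) j.2))))
    (fun j => s j.1 j.2.+1) ->
  computes D sz a (fun i => s i (size (l i))).
Proof.
move=> lsz Hl H0 [p [t [tP Hs]]].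
have := @computes_fold R I D sz a (fun i => [seq enc i x | x <- l i]) s.
under [X in _ -> _ -> _ -> _ -> computes _ _ _ X]eq_fun do rewrite size_map.
apply=> //; first by move=> i Di; rewrite size_map lsz.
exists p, t; split.
  by case: tP => c [k tP]; exists c, k => -[i n] /=; rewrite size_map; exact: (tP (i, n)).
move=> [i n] /= []; rewrite size_map => Di ln.
by rewrite (nth_map (x0 i)) //; exact: (Hs (i, n)).
Qed.

(** A loop walks along one list; the unread part of the other one travels in its state. *)
Lemma computes_zip (R : realType) (I : Type) D sz (a : I -> value R)
    (l l' : I -> seq (value R)) :
  (forall i, D i -> (size (l i) <= sz i)%N) ->
  (forall i, D i -> size (l' i) = size (l i)) ->
  computes D sz a (fun i => enc_seq (l i)) ->
  computes D sz a (fun i => enc_seq (l' i)) ->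
  computes D sz a (fun i => enc_seq [seq VPair p.1 p.2 | p <- zip (l i) (l' i)]).
Proof.
move=> lsz ll' Hl Hl'.
pose z i := [seq VPair p.1 p.2 | p <- zip (l i) (l' i)].
have zsz i : D i -> size (z i) = size (l i).
  by move=> Di; rewrite size_map size1_zip // ll'.
suff : computes D sz a (fun i => enc_seq (rev (z i))).
  move=> /computes_rev H; have := H _.
  under eq_fun do rewrite revK; apply=> i Di.
  by rewrite size_rev zsz // lsz.
apply: (@computes_snd _ _ _ _ _ (fun i => enc_seq (drop (size (l i)) (l' i)))).
apply: (@computes_ext _ _ _ _ _ (fun i => VPair
  (enc_seq (drop (size (l i)) (l' i))) (enc_seq (rev (take (size (l i)) (z i)))))).
  by move=> i Di; rewrite -(zsz i Di) take_size.
apply: (@computes_fold R I D sz a l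
  (fun i k => VPair (enc_seq (drop k (l' i))) (enc_seq (rev (take k (z i)))))) => //.
  under eq_fun do rewrite drop0 take0.
  by apply: computes_pair => //; exact: computes_nil.
have Hs : computes (fun j : I * nat => D j.1 /\ (j.2 < size (l j.1))%N) (sz \o fst)
    (fun j => VPair (a j.1) (VPair
      (VPair (enc_seq (drop j.2 (l' j.1))) (enc_seq (rev (take j.2 (z j.1)))))
      (nth VNil (l j.1) j.2)))
    (fun j => VPair (nth VNil (l' j.1) j.2) (enc_seq (drop j.2.+1 (l' j.1)))).
  apply: computes_ext (computes_fst (computes_state _ _ _ _ _)) => -[i k] /= [Di ki].
  by rewrite (drop_nth VNil) // ll'.
apply: computes_pair; first exact: computes_snd Hs.
have := computes_pair (computes_pair (computes_item _ _ _ _ _) (computes_fst Hs))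
  (computes_snd (computes_state _ _ _ _ _)).
apply: computes_ext => -[i k] /= [Di ki].
rewrite (take_nth VNil) ?zsz // rev_rcons /=; congr (VPair _ _).
rewrite (nth_map (VNil, VNil)) ?size1_zip ?ll' //.
by rewrite nth_zip ?ll'.
Qed.

Lemma computes_size (R : realType) (I : Type) D sz (a : I -> value R)
    (l : I -> seq (value R)) :
  (forall i, D i -> (size (l i) <= sz i)%N) ->
  computes D sz a (fun i => enc_seq (l i)) ->
  computes D sz a (fun i => VNum (size (l i))%:R).
Proof.
move=> lsz Hl; apply: (@computes_fold _ _ _ _ _ l (fun i k => VNum k%:R)) => //.
  exact: computes_zero.
under [X in computes _ _ _ X]eq_fun do rewrite -natr1.
apply: computes_add; [exact: computes_state|exact: computes_one].
Qed.

(** * Arithmetic of encoded vectors *)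

Definition vec_seq (R : realType) d (u : 'rV[R]_d) : seq R :=
  [seq u 0 j | j <- enum 'I_d].

Lemma size_vec_seq (R : realType) d (u : 'rV[R]_d) : size (vec_seq u) = d.
Proof. by rewrite size_map size_enum_ord. Qed.

Lemma nth_vec_seq (R : realType) d (u : 'rV[R]_d) (j : 'I_d) :
  nth 0 (vec_seq u) j = u 0 j.
Proof. by rewrite (nth_map j) ?size_enum_ord // nth_ord_enum. Qed.

Lemma computes_vec2 (R : realType) (I : Type) D sz (a : I -> value R) d
    (u v : forall i, 'rV[R]_(d i)) :
  (forall i, D i -> (d i <= sz i)%N) ->
  computes D sz a (fun i => enc_vec (u i)) ->
  computes D sz a (fun i => enc_vec (v i)) ->
  computes D sz a (fun i => enc_seq [seq VPair (VNum p.1) (VNum p.2)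
    | p <- zip (vec_seq (u i)) (vec_seq (v i))]).
Proof.
move=> dsz Hu Hv.
have := @computes_zip _ _ D sz a (fun i => map (@VNum R) (vec_seq (u i)))
  (fun i => map (@VNum R) (vec_seq (v i))) _ _ Hu Hv.
move=> H; apply: computes_ext (H _ _).
- by move=> i _; rewrite /vec_seq -[in LHS]map_comp -[in X in zip _ X]map_comp !zip_map -!map_comp.
- by move=> i Di; rewrite size_map size_vec_seq dsz.
- by move=> i Di; rewrite !size_map.
Qed.

Lemma computes_dot (R : realType) (I : Type) D sz (a : I -> value R) d
    (u v : forall i, 'rV[R]_(d i)) :
  (forall i, D i -> (d i <= sz i)%N) ->
  computes D sz a (fun i => enc_vec (u i)) ->
  computes D sz a (fun i => enc_vec (v i)) ->
  computes D sz a (fun i => VNum (dot (u i) (v i))).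
Proof.
move=> dsz Hu Hv; have Hz := computes_vec2 dsz Hu Hv.
have szz i : size (zip (vec_seq (u i)) (vec_seq (v i))) = d i.
  by rewrite size1_zip ?size_vec_seq.
have -> : (fun i => VNum (dot (u i) (v i))) =
    (fun i => VNum (\sum_(0 <= j < size (zip (vec_seq (u i)) (vec_seq (v i))))
       nth 0 (vec_seq (u i)) j * nth 0 (vec_seq (v i)) j)).
  apply/funext => i; rewrite szz big_mkord; congr VNum.
  by apply: eq_bigr => j _; rewrite !nth_vec_seq.
apply: (@computes_foldT _ _ _ _ _ (fun=> (R * R)%type) (fun=> (0, 0)) _ _
  (fun i k => VNum (\sum_(0 <= j < k)
    nth 0 (vec_seq (u i)) j * nth 0 (vec_seq (v i)) j)) _ Hz).
- by move=> i Di; rewrite szz dsz.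
- by under eq_fun do rewrite big_nil; exact: computes_zero.
- under [X in computes _ _ _ X]eq_fun do rewrite big_nat_recr //=.
  apply: computes_add; first exact: computes_state.
  have := @computes_item R _ (fun j : I * nat => D j.1 /\
    (j.2 < size (zip (vec_seq (u j.1)) (vec_seq (v j.1))))%N) (sz \o fst)
    (fun j => a j.1) (fun j => VNum (\sum_(0 <= n < j.2)
       nth 0 (vec_seq (u j.1)) n * nth 0 (vec_seq (v j.1)) n))
    (fun j => VPair (VNum (nth 0 (vec_seq (u j.1)) j.2))
                    (VNum (nth 0 (vec_seq (v j.1)) j.2))).
  under [X in computes _ _ X _]eq_fun => j.
    have -> : VPair (VNum (nth 0 (vec_seq (u j.1)) j.2))
                    (VNum (nth 0 (vec_seq (v j.1)) j.2)) =
      (fun p => VPair (VNum p.1) (VNum p.2)) (nth (0, 0)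
         (zip (vec_seq (u j.1)) (vec_seq (v j.1))) j.2).
      by rewrite nth_zip ?size_vec_seq.
    over.
  by move=> H; apply: computes_mul; [apply: computes_fst H|apply: computes_snd H].
Qed.

Lemma computes_axpy (R : realType) (I : Type) D sz (a : I -> value R) d
    c (u v : forall i, 'rV[R]_(d i)) :
  (forall i, D i -> (d i <= sz i)%N) ->
  computes D sz a (fun i => VNum (c i)) ->
  computes D sz a (fun i => enc_vec (u i)) ->
  computes D sz a (fun i => enc_vec (v i)) ->
  computes D sz a (fun i => enc_vec (c i *: u i + v i)).
Proof.
move=> dsz Hc Hu Hv; have Hz := computes_vec2 dsz Hu Hv.
have szz i : size (zip (vec_seq (u i)) (vec_seq (v i))) = d i.
  by rewrite size1_zip ?size_vec_seq.
have := @computes_map _ _ _ _ _ _ (fun i k => VNum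
  (c i * nth 0 (vec_seq (u i)) k + nth 0 (vec_seq (v i)) k)) _ Hz.
have -> : (fun i => enc_vec (c i *: u i + v i)) = (fun i => enc_seq (mkseq (fun k =>
  VNum (c i * nth 0 (vec_seq (u i)) k + nth 0 (vec_seq (v i)) k))
  (size [seq VPair (VNum p.1) (VNum p.2)
                  | p <- zip (vec_seq (u i)) (vec_seq (v i))]))).
  apply/funext => i; rewrite size_map szz; congr enc_seq.
  rewrite /mkseq -val_enum_ord -!map_comp; apply: eq_map => j /=.
  by rewrite !nth_vec_seq !mxE.
apply; first by move=> i Di; rewrite size_map szz dsz.
have H : computes
    (fun j => D j.1 /\ (j.2 < size [seq VPair (VNum p.1) (VNum p.2)
      | p <- zip (vec_seq (u j.1)) (vec_seq (v j.1))])%N) (sz \o fst)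
    (fun j : I * nat => VPair (a j.1) (nth VNil [seq VPair (VNum p.1) (VNum p.2)
      | p <- zip (vec_seq (u j.1)) (vec_seq (v j.1))] j.2))
    (fun j => VPair (VNum (nth 0 (vec_seq (u j.1)) j.2))
                    (VNum (nth 0 (vec_seq (v j.1)) j.2))).
  apply: computes_ext (computes_snd (computes_id _ _ _)) => -[i k] /= [Di].
  rewrite size_map => ki; rewrite (nth_map (0, 0)) //=.
  by rewrite nth_zip ?size_vec_seq.
apply: computes_add; last exact: computes_snd H.
apply: computes_mul; last exact: computes_fst H.
exact: (@computes_outer _ _ _ _ _ _ (fun i => VNum (c i))).
Qed.

(** * The algorithm *)

(** The clock makes [F] total: [g x l] takes time linear in the length of the clock on every input,
    legitimate or not. *)
Lemma computes_clocked (R : realType) (F : prog) :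
  exists g : value R -> seq (value R) -> value R,
  (forall x l y t, exec F x y t -> (t <= size l)%N -> g x l = y) /\
  forall (I : Type) D sz (a x : I -> value R) (l : I -> seq (value R)),
    (forall i, D i -> (size (l i) <= sz i)%N) ->
    computes D sz a x -> computes D sz a (fun i => enc_seq (l i)) ->
    computes D sz a (fun i => g (x i) (l i)).
Proof.
have [c [g Hg]] := clocked_fun R F; exists g; split.
  by move=> x l; have [_] := Hg x l; auto.
move=> I D sz a x l lsz Hx Hl; apply: computes_comp (computes_pair Hx Hl) _.
exists (Seq (clocked F) pfst), (fun i => c * (sz i).+1)%N; split.
  by exists c, 1%N => i _; rewrite expn1.
move=> i Di; have [E _] := Hg (x i) (l i); apply: within_le E _.
by rewrite leq_mul2l ltnS lsz // orbT.
Qed.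


Lemma computes_vsub (R : realType) (I : Type) D sz (a : I -> value R) d
    (u v : forall i, 'rV[R]_(d i)) :
  (forall i, D i -> (d i <= sz i)%N) ->
  computes D sz a (fun i => enc_vec (u i)) ->
  computes D sz a (fun i => enc_vec (v i)) ->
  computes D sz a (fun i => enc_vec (u i - v i)).
Proof.
move=> dsz Hu Hv.
have := computes_axpy dsz (computes_subr (computes_zero _ _ _) (computes_one _ _ _)) Hv Hu.
by apply: computes_ext => i _; rewrite sub0r scaleN1r addrC.
Qed.

Lemma computes_vscale (R : realType) (I : Type) D sz (a : I -> value R) d
    c (u : forall i, 'rV[R]_(d i)) :
  (forall i, D i -> (d i <= sz i)%N) ->
  computes D sz a (fun i => VNum (c i)) ->
  computes D sz a (fun i => enc_vec (u i)) ->
  computes D sz a (fun i => enc_vec (c i *: u i)).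
Proof.
(* [u - u] supplies the zero vector of the right dimension. *)
move=> dsz Hc Hu; have := computes_axpy dsz Hc Hu (computes_vsub dsz Hu Hu).
by apply: computes_ext => i _; rewrite subrr addr0.
Qed.

(** * Empirical mean and the test on the covariance *)

Definition lmean (R : realType) d (rows : seq 'rV[R]_d) : 'rV[R]_d :=
  (size rows)%:R^-1 *: \sum_(x <- rows) x.

Definition enc_rows (R : realType) d (rows : seq 'rV[R]_d) : value R :=
  enc_seq [seq enc_vec x | x <- rows].

Lemma computes_count (R : realType) (I : Type) D sz (a : I -> value R) d
    (rows : forall i, seq 'rV[R]_(d i)) :
  (forall i, D i -> (size (rows i) <= sz i)%N) ->
  computes D sz a (fun i => enc_rows (rows i)) ->
  computes D sz a (fun i => VNum (size (rows i))%:R).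
Proof.
move=> rsz Hr.
have := @computes_size _ _ D sz a (fun i => [seq enc_vec x | x <- rows i]) _ Hr.
move=> H; apply: computes_ext (H _) => [i _|i Di]; rewrite size_map //.
exact: rsz.
Qed.

Lemma computes_lmean (R : realType) (I : Type) D sz (a : I -> value R) d
    (rows : forall i, seq 'rV[R]_(d i)) :
  (forall i, D i -> (d i <= sz i)%N) ->
  (forall i, D i -> (size (rows i) <= sz i)%N) ->
  computes D sz a (fun i => enc_vec (0 : 'rV[R]_(d i))) ->
  computes D sz a (fun i => enc_rows (rows i)) ->
  computes D sz a (fun i => enc_vec (lmean (rows i))).
Proof.
move=> dsz rsz H0 Hr; apply: computes_vscale => //.
  apply: (@computes_ext _ _ _ _ _ (fun i => VNum (1 / (size (rows i))%:R))).
    by move=> i _; rewrite mul1r.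
  by apply: computes_div (computes_one _ _ _) (computes_count rsz Hr).
apply: (@computes_ext _ _ _ _ _
  (fun i => enc_vec (\sum_(x <- take (size (rows i)) (rows i)) x))).
  by move=> i _; rewrite take_size.
apply: (@computes_foldT _ _ _ _ _ (fun i => 'rV[R]_(d i)) (fun=> 0)
  (fun i => @enc_vec R (d i)) rows
  (fun i k => enc_vec (\sum_(x <- take k (rows i)) x))) => //.
  by under eq_fun do rewrite take0 big_nil.
have := @computes_axpy R (I * nat) (fun j : I * nat => D j.1 /\ (j.2 < size (rows j.1))%N)
  (sz \o fst) (fun j => VPair (a j.1)
    (VPair (enc_vec (\sum_(x <- take j.2 (rows j.1)) x))
       (enc_vec (nth 0 (rows j.1) j.2)))) (fun j => d j.1) (fun=> 1)
  (fun j => nth 0 (rows j.1) j.2) (fun j => \sum_(x <- take j.2 (rows j.1)) x).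
move=> H; apply: computes_ext (H _ _ _ _).
- move=> [i k] /= [Di ki]; rewrite scale1r addrC.
  by rewrite (take_nth 0 ki) big_rcons.
- by move=> j [Dj _]; exact: dsz.
- exact: computes_one.
- exact: computes_item.
- exact: computes_state.
Qed.

(* If [B(v, w) = c v.w - sum_(y <- ys) (y.v)(y.w)] then each pair [(z, q)]
   recorded by [pivots c ys] comes from a rank-one downdate of [B]: [z]
   represents [y] with respect to the form built so far, and [q = 1 - y.z].
   The updated inverse of [B] is kept in this factored form. *)
Definition solve (R : realType) d (c : R) (L : seq ('rV[R]_d * R)) (y : 'rV[R]_d) :=
  c^-1 *: y + \sum_(p <- L) (dot p.1 y / p.2) *: p.1.

Definition pivot (R : realType) d (c : R) (L : seq ('rV[R]_d * R)) (y : 'rV[R]_d) :=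
  (solve c L y, 1 - dot y (solve c L y)).

Definition pivots (R : realType) d (c : R) (ys : seq 'rV[R]_d) :=
  foldl (fun L y => pivot c L y :: L) [::] ys.

(** Positive pivots mean that the sum of the (y.v)^2 stays below ((1 + lam) m + 1) |v|^2, that is,
    Cov <= 1 + lam + 1/m. The final 1 also keeps the initial form positive when there are no
    rows. *)
Definition spread_test (R : realType) d (lam : R) (rows : seq 'rV[R]_d) : bool :=
  all (fun p => 0 < p.2) (pivots ((1 + lam) * (size rows)%:R + 1)
    [seq x - lmean rows | x <- rows]).

Lemma pivots_rcons (R : realType) d (c : R) (ys : seq 'rV[R]_d) y :
  pivots c (rcons ys y) = pivot c (pivots c ys) y :: pivots c ys.
Proof. by rewrite /pivots -cats1 foldl_cat. Qed.

Lemma size_pivots (R : realType) d (c : R) (ys : seq 'rV[R]_d) :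
  size (pivots c ys) = size ys.
Proof.
elim/last_ind: ys => [//|ys y IH].
by rewrite pivots_rcons size_rcons /= IH.
Qed.

Definition enc_pair (R : realType) d (p : 'rV[R]_d * R) : value R :=
  VPair (enc_vec p.1) (VNum p.2).

Lemma computes_solve (R : realType) (I : Type) D sz (a : I -> value R) d c
    (L : forall i, seq ('rV[R]_(d i) * R)) (y : forall i, 'rV[R]_(d i)) :
  (forall i, D i -> (d i <= sz i)%N) ->
  (forall i, D i -> (size (L i) <= sz i)%N) ->
  computes D sz a (fun i => VNum (c i)) ->
  computes D sz a (fun i => enc_seq [seq enc_pair p | p <- L i]) ->
  computes D sz a (fun i => enc_vec (y i)) ->
  computes D sz a (fun i => enc_vec (solve (c i) (L i) (y i))).
Proof.
move=> dsz Lsz Hc HL Hy.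
apply: (@computes_ext _ _ _ _ _ (fun i => enc_vec ((c i)^-1 *: y i +
  \sum_(p <- take (size (L i)) (L i)) (dot p.1 (y i) / p.2) *: p.1))).
  by move=> i _; rewrite take_size.
apply: (@computes_foldT _ _ _ _ _ (fun i => 'rV[R]_(d i) * R)%type (fun=> (0, 0))
  (fun i => @enc_pair R (d i)) L
  (fun i k => enc_vec ((c i)^-1 *: y i +
     \sum_(p <- take k (L i)) (dot p.1 (y i) / p.2) *: p.1))) => //.
  apply: (@computes_ext _ _ _ _ _ (fun i => enc_vec ((1 / c i) *: y i))).
    by move=> i _; rewrite take0 big_nil addr0 mul1r.
  apply: computes_vscale => //.
  exact: computes_div (computes_one _ _ _) Hc.
set D' := fun j : I * nat => _.
set a' := fun j : I * nat => VPair (a j.1) _.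
have Hitem : computes D' (sz \o fst) a' (fun j => enc_pair (nth (0, 0) (L j.1) j.2)).
  exact: computes_item.
have := @computes_axpy R _ D' (sz \o fst) a' (fun j => d j.1)
  (fun j => dot (nth (0, 0) (L j.1) j.2).1 (y j.1) / (nth (0, 0) (L j.1) j.2).2)
  (fun j => (nth (0, 0) (L j.1) j.2).1) (fun j => (c j.1)^-1 *: y j.1 +
     \sum_(p <- take j.2 (L j.1)) (dot p.1 (y j.1) / p.2) *: p.1).
move=> H; apply: computes_ext (H _ _ _ _).
- move=> [i k] /= [Di ki]; rewrite addrC -addrA; congr (enc_vec (_ + _)).
  by rewrite (take_nth (0, 0) ki) big_rcons /= addrC.
- by move=> j [Dj _]; exact: dsz.
- apply: computes_div; last exact: computes_snd Hitem.
  apply: computes_dot; last exact: computes_outer Hy.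
    by move=> j [Dj _]; exact: dsz.
  exact: computes_fst Hitem.
- exact: computes_fst Hitem.
- exact: computes_state.
Qed.

Lemma computes_spread_test (R : realType) (I : Type) D sz (a : I -> value R) d lam
    (rows : forall i, seq 'rV[R]_(d i)) :
  (forall i, D i -> (d i <= sz i)%N) ->
  (forall i, D i -> (size (rows i) <= sz i)%N) ->
  computes D sz a (fun i => VNum (lam i)) ->
  computes D sz a (fun i => enc_vec (0 : 'rV[R]_(d i))) ->
  computes D sz a (fun i => enc_rows (rows i)) ->
  computes D sz a (fun i => vbool R (spread_test (lam i) (rows i))).
Proof.
move=> dsz rsz Hlam H0 Hr.
pose c i := (1 + lam i) * (size (rows i))%:R + 1.
have Hc : computes D sz a (fun i => VNum (c i)).
  apply: computes_add; last exact: computes_one.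
  apply: computes_mul; last exact: computes_count.
  by apply: computes_add Hlam; exact: computes_one.
have Hmu := computes_lmean dsz rsz H0 Hr.
pose L i k := pivots (c i) [seq x - lmean (rows i) | x <- take k (rows i)].
apply: (@computes_ext _ _ _ _ _ (fun i => vbool R
    (all (fun p => 0 < p.2) (L i (size (rows i)))))).
  by move=> i _; rewrite /L take_size.
(* The loop carries a sign flag along with the pivots: after a nonpositive pivot the arithmetic goes
   on, but the flag stays false. *)
apply: (@computes_snd _ _ _ _ _ (fun i =>
  enc_seq [seq enc_pair p | p <- L i (size (rows i))])).
apply: (@computes_foldT _ _ _ _ _ (fun i => 'rV[R]_(d i)) (fun=> 0)
  (fun i => @enc_vec R (d i)) rows
  (fun i k => VPair (enc_seq [seq enc_pair p | p <- L i k])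
     (vbool R (all (fun p => 0 < p.2) (L i k))))) => //.
  under eq_fun do rewrite /L take0 /=.
  apply: computes_pair; first exact: computes_nil.
  by apply: computes_pair; exact: computes_nil.
set D' := fun j : I * nat => _.
set a' := fun j : I * nat => VPair (a j.1) _.
have dsz' j : D' j -> (d j.1 <= (sz \o fst) j)%N by case=> + _; exact: dsz.
pose y (j : I * nat) := nth 0 (rows j.1) j.2 - lmean (rows j.1).
pose z (j : I * nat) := solve (c j.1) (L j.1 j.2) (y j).
have Hy : computes D' (sz \o fst) a' (fun j => enc_vec (y j)).
  apply: computes_vsub => //; first exact: computes_item.
  exact: computes_outer Hmu.
have HL : computes D' (sz \o fst) a' (fun j => enc_seq [seq enc_pair p | p <- L j.1 j.2]).
  exact/computes_fst/computes_state.
have Hz : computes D' (sz \o fst) a' (fun j => enc_vec (z j)).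
  apply: computes_solve => //.
    move=> [i k] /= [Di ki]; rewrite size_pivots size_map size_take ki.
    by apply: leq_trans (ltnW ki) _; exact: rsz.
  exact: computes_outer Hc.
have Hq : computes D' (sz \o fst) a' (fun j => VNum (1 - dot (y j) (z j))).
  apply: computes_subr; first exact: computes_one.
  exact: (@computes_dot _ _ _ _ _ (fun j => d j.1)).
have := computes_pair (computes_pair (computes_pair Hz Hq) HL)
  (computes_and (computes_prim OpPos Hq) (computes_snd (computes_state _ _ _ _ _))).
apply: computes_ext => -[i k] /= [Di ki].
by rewrite /L (take_nth 0 ki) map_rcons pivots_rcons.
Qed.

(** * Reading the output of the filter and thresholding it *)

Definition vtail (R : realType) (y : value R) k : value R := iter k (prim_eval OpSnd) y.
Definition vitem (R : realType) (y : value R) k : value R := prim_eval OpFst (vtail y k).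
Definition vnum (R : realType) (v : value R) : R := if v is VNum b then b else 0.
Definition vgt (R : realType) (v : value R) (a : R) : bool :=
  if v is VNum b then a < b else false.

(* The output of the filter is an arbitrary value unless the filter is run on a
   legitimate instance: entries that are not numbers are never selected. *)
Fixpoint vmax (R : realType) (y : value R) k : R :=
  if k is k'.+1 then
    if vgt (vitem y k') (vmax y k') then vnum (vitem y k') else vmax y k'
  else 0.

Definition kept (R : realType) (A : Type) (x0 : A) (y : value R) (a : R)
    (rows : seq A) k : seq A :=
  [seq nth x0 rows j | j <- iota 0 k & ~~ vgt (vitem y j) a].

Lemma size_kept (R : realType) (A : Type) (x0 : A) (y : value R) (a : R) rows k :
  (size (kept x0 y a rows k) <= k)%N.
Proof.
by rewrite size_map size_filter (leq_trans (count_size _ _)) ?size_iota.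
Qed.

Lemma keptS (R : realType) (A : Type) (x0 : A) (y : value R) (a : R) rows k :
  kept x0 y a rows k.+1 = if vgt (vitem y k) a then kept x0 y a rows k
    else rcons (kept x0 y a rows k) (nth x0 rows k).
Proof.
rewrite /kept -addn1 iotaD filter_cat map_cat add0n /=.
by case: vgt; rewrite /= ?cats0 ?cats1.
Qed.

Lemma computes_vgt (R : realType) (I : Type) D sz (a v : I -> value R) x :
  computes D sz a v -> computes D sz a (fun i => VNum (x i)) ->
  computes D sz a (fun i => vbool R (vgt (v i) (x i))).
Proof.
move=> Hv Hx; have := computes_prim OpPos (computes_prim OpSub (computes_pair Hv Hx)).
apply: computes_ext => i _ /=; case: (v i) => [|b|b b'] //=.
by rewrite subr_gt0.
Qed.

Lemma computes_vmax (R : realType) (I : Type) D sz (a y : I -> value R)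
    (l : I -> seq (value R)) :
  (forall i, D i -> (size (l i) <= sz i)%N) ->
  computes D sz a (fun i => enc_seq (l i)) -> computes D sz a y ->
  computes D sz a (fun i => VNum (vmax (y i) (size (l i)))).
Proof.
move=> lsz Hl Hy.
apply: (@computes_snd _ _ _ _ _ (fun i => vtail (y i) (size (l i)))).
apply: (@computes_fold _ _ _ _ _ l
  (fun i k => VPair (vtail (y i) k) (VNum (vmax (y i) k)))) => //.
  exact: computes_pair Hy (computes_zero _ _ _).
set D' := fun j : I * nat => _.
set a' := fun j : I * nat => VPair (a j.1) _.
have Hs : computes D' (sz \o fst) a'
    (fun j => VPair (vtail (y j.1) j.2) (VNum (vmax (y j.1) j.2))).
  exact: computes_state.
have Hi : computes D' (sz \o fst) a' (fun j => vitem (y j.1) j.2).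
  exact: computes_prim OpFst (computes_fst Hs).
apply: computes_pair; first exact: computes_prim OpSnd (computes_fst Hs).
have Hc := computes_vgt Hi (computes_snd Hs).
have := computes_if Hc (computes_sub _ Hi) (computes_sub _ (computes_snd Hs)).
move=> H; apply: computes_ext (H _ _) => [j _|j []|j []] //=.
by case: ifP => //; case: vitem.
Qed.

Lemma computes_kept (R : realType) (I : Type) D sz (a y : I -> value R) x d
    (rows : forall i, seq 'rV[R]_(d i)) :
  (forall i, D i -> (size (rows i) <= sz i)%N) ->
  computes D sz a (fun i => enc_rows (rows i)) -> computes D sz a y ->
  computes D sz a (fun i => VNum (x i)) ->
  computes D sz a (fun i =>
    enc_rows (kept 0 (y i) (x i) (rows i) (size (rows i)))).
Proof.
move=> rsz Hr Hy Hx.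
suff : computes D sz a (fun i => enc_seq (rev
    [seq enc_vec v | v <- kept 0 (y i) (x i) (rows i) (size (rows i))])).
  move=> /computes_rev H; have := H _; under eq_fun do rewrite revK.
  apply=> i Di; rewrite size_rev size_map.
  exact: leq_trans (size_kept _ _ _ _ _) (rsz i Di).
apply: (@computes_snd _ _ _ _ _ (fun i => vtail (y i) (size (rows i)))).
apply: (@computes_foldT _ _ _ _ _ (fun i => 'rV[R]_(d i)) (fun=> 0)
  (fun i => @enc_vec R (d i)) rows
  (fun i k => VPair (vtail (y i) k)
     (enc_seq (rev [seq enc_vec v | v <- kept 0 (y i) (x i) (rows i) k])))) => //.
  exact: computes_pair Hy (computes_nil _ _ _).
set D' := fun j : I * nat => _.
set a' := fun j : I * nat => VPair (a j.1) _.
have Hs : computes D' (sz \o fst) a'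
    (fun j => VPair (vtail (y j.1) j.2) (enc_seq (rev
      [seq enc_vec v | v <- kept 0 (y j.1) (x j.1) (rows j.1) j.2]))).
  exact: computes_state.
have Hi : computes D' (sz \o fst) a' (fun j => vitem (y j.1) j.2).
  exact: computes_prim OpFst (computes_fst Hs).
have Hx' : computes D' (sz \o fst) a' (fun j => VNum (x j.1)).
  exact: computes_outer Hx.
apply: computes_pair; first exact: computes_prim OpSnd (computes_fst Hs).
have Hn := computes_pair (computes_item D' (sz \o fst) (fun j => a j.1)
    (fun j => VPair (vtail (y j.1) j.2) (enc_seq (rev
      [seq enc_vec v | v <- kept 0 (y j.1) (x j.1) (rows j.1) j.2])))
    (fun j => enc_vec (nth 0 (rows j.1) j.2))) (computes_snd Hs).
have := computes_if (computes_vgt Hi Hx') (computes_sub _ (computes_snd Hs))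
  (computes_sub _ Hn).
move=> H; apply: computes_ext (H _ _) => [j _|j []|j []] //=.
by rewrite keptS; case: ifP => // _; rewrite map_rcons rev_rcons.
Qed.

(** The last flip is the most significant bit, so that one pass suffices without powers of 2. The
    number 2 is written 1 + 1 because the language has only the constants 0 and 1. *)
Definition coin_value (R : realType) (r : seq bool) : R :=
  foldl (fun u b => (u + (nat_of_bool b)%:R) / (1 + 1)) 0 r.

Lemma coin_value_rcons (R : realType) r b :
  coin_value R (rcons r b) = (coin_value R r + (nat_of_bool b)%:R) / (1 + 1).
Proof. by rewrite /coin_value -cats1 foldl_cat. Qed.

(** Loops run over lists, so the 2n flips are counted by walking twice along a list [l] of length
    n. *)
Lemma computes_coin_value (R : realType) (I : Type) D sz (a : I -> value R)
    (r : I -> seq bool) (l : I -> seq (value R)) :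
  (forall i, D i -> (size (l i) <= sz i)%N) ->
  (forall i, D i -> (size (l i) + size (l i) <= size (r i))%N) ->
  computes D sz a (fun i => enc_seq (l i)) ->
  computes D sz a (fun i => enc_bits R (r i)) ->
  computes D sz a (fun i =>
    VPair (VNum (coin_value R (take (size (l i) + size (l i)) (r i))))
          (enc_bits R (drop (size (l i) + size (l i)) (r i)))).
Proof.
move=> lsz lr Hl Hr.
pose s i k := VPair (VNum (coin_value R (take k (r i)))) (enc_bits R (drop k (r i))).
have step (m : I -> nat) : (forall i, D i -> (m i + size (l i) <= size (r i))%N) ->
    computes D sz a (fun i => s i (m i + 0)%N) ->
    computes D sz a (fun i => s i (m i + size (l i))%N).
  move=> mr H0.
  apply: (@computes_fold _ _ _ _ _ l (fun i k => s i (m i + k)%N)) => //.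
  set D' := fun j : I * nat => _.
  set a' := fun j : I * nat => VPair (a j.1) _.
  have Hs : computes D' (sz \o fst) a' (fun j => s j.1 (m j.1 + j.2)%N).
    exact: computes_state.
  have Hb : computes D' (sz \o fst) a' (fun j => VPair
      (VNum (nat_of_bool (nth false (r j.1) (m j.1 + j.2)))%:R)
      (enc_bits R (drop (m j.1 + j.2).+1 (r j.1)))).
    apply: computes_ext (computes_snd Hs) => -[i k] /= [/= Di /= ki].
    by rewrite [drop (m i + k) _](drop_nth false) //; have := mr i Di; lia.
  have := computes_pair (computes_div (computes_add (computes_fst Hs) (computes_fst Hb))
    (computes_add (computes_one _ _ _) (computes_one _ _ _))) (computes_snd Hb).
  apply: computes_ext => -[i k] /= [/= Di /= ki].
  rewrite /s addnS [take (m i + k).+1 _](take_nth false) ?coin_value_rcons //.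
  by have := mr i Di; lia.
apply: (step (fun i => size (l i))) => //.
under eq_fun do rewrite addn0.
apply: (step (fun=> 0%N)); first by move=> i Di; have := lr i Di; lia.
under eq_fun do rewrite add0n /s take0 drop0.
exact: computes_pair (computes_zero _ _ _) Hr.
Qed.

(** An index type on which [computes] speaks of one program for all sample sizes, dimensions and
    coin lists. *)
Record instance (R : realType) := Instance {
  params : seq R; threshold : R; dimension : nat;
  points : seq 'rV[R]_dimension; coins : seq bool }.

Definition input (R : realType) (i : instance R) : value R :=
  enc_input (params i) (threshold i) (points i).

Definition input_size (R : realType) (i : instance R) : nat :=
  (vsize (input i) + size (coins i))%N.

Definition bit_values (R : realType) (r : seq bool) : seq (value R) :=
  [seq VNum (nat_of_bool b)%:R | b <- r].

Lemma enc_bitsE (R : realType) (r : seq bool) :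
  enc_bits R r = enc_seq (bit_values R r).
Proof. by rewrite /enc_bits /enc_nums -map_comp. Qed.

Definition filter_round (R : realType) (g : value R -> seq (value R) -> value R)
    (par : seq R) (lam : R) d (r : seq bool) (rows : seq 'rV[R]_d) (u : R) :=
  if spread_test lam rows then rows else
  let y := g (enc_input par lam rows) (bit_values R r) in
  kept 0 y (u * vmax y (size rows)) rows (size rows).

Lemma size_filter_round (R : realType) g par lam d r (rows : seq 'rV[R]_d) u :
  (size (filter_round g par lam r rows u) <= size rows)%N.
Proof. by rewrite /filter_round; case: ifP => // _; exact: size_kept. Qed.

(** [estimate] passes the same coins twice: [r] is the clock, of which only the length matters once
    the filter keeps its time bound, while [r'] is consumed m flips per round. Keeping them apart
    makes it possible to reason on the flips still to come. *)
Fixpoint filter_rounds (R : realType) (g : value R -> seq (value R) -> value R)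
    (par : seq R) (lam : R) d (r : seq bool) m (r' : seq bool)
    (rows : seq 'rV[R]_d) k : seq 'rV[R]_d :=
  if k is k'.+1 then
    filter_round g par lam r (filter_rounds g par lam r m r' rows k')
      (coin_value R (take m (drop (k' * m) r')))
  else rows.

Lemma size_filter_rounds (R : realType) g par lam d r m r' (rows : seq 'rV[R]_d) k :
  (size (filter_rounds g par lam r m r' rows k) <= size rows)%N.
Proof.
elim: k => //= k; apply: leq_trans; exact: size_filter_round.
Qed.

Definition estimate (R : realType) (g : value R -> seq (value R) -> value R)
    (i : instance R) : 'rV[R]_(dimension i) :=
  let n := size (points i) in
  lmean (filter_rounds g (params i) (threshold i) (coins i) (n + n) (coins i)
    (points i) n).

Lemma computes_filter_round (R : realType) (F : prog) :
  exists g : value R -> seq (value R) -> value R,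
  (forall x l y t, exec F x y t -> (t <= size l)%N -> g x l = y) /\
  forall (I : Type) D sz (a : I -> value R) par lam (d : I -> nat) r
    (rows : forall i, seq 'rV[R]_(d i)) u,
  (forall i, D i -> (d i <= sz i)%N) ->
  (forall i, D i -> (size (rows i) <= sz i)%N) ->
  (forall i, D i -> (size (r i) <= sz i)%N) ->
  computes D sz a (fun i => enc_nums (par i)) ->
  computes D sz a (fun i => VNum (lam i)) ->
  computes D sz a (fun i => enc_bits R (r i)) ->
  computes D sz a (fun i => VNum (u i)) ->
  computes D sz a (fun i => enc_vec (0 : 'rV[R]_(d i))) ->
  computes D sz a (fun i => enc_rows (rows i)) ->
  computes D sz a (fun i =>
    enc_rows (filter_round g (par i) (lam i) (r i) (rows i) (u i))).
Proof.
have [g [gP Hg]] := computes_clocked R F; exists g; split=> //.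
move=> I D sz a par lam d r rows u dsz rsz rrsz Hpar Hlam Hr Hu H0 Hrows.
pose y i := g (enc_input (par i) (lam i) (rows i)) (bit_values R (r i)).
have Hy : computes D sz a y.
  apply: Hg.
  - by move=> i Di; rewrite size_map rrsz.
  - by apply: computes_pair => //; exact: computes_pair.
  - by apply: computes_ext Hr => i _; rewrite enc_bitsE.
have Hmax : computes D sz a (fun i => VNum (vmax (y i) (size (rows i)))).
  have := @computes_vmax _ _ D sz a y (fun i => [seq enc_vec v | v <- rows i]) _ Hrows Hy.
  move=> H; apply: computes_ext (H _) => [i _|i Di]; rewrite size_map //.
  exact: rsz.
have Hk := computes_kept rsz Hrows Hy (computes_mul Hu Hmax).
have := computes_if (computes_spread_test dsz rsz Hlam H0 Hrows)
  (computes_sub _ Hrows) (computes_sub _ Hk).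
move=> H; apply: computes_ext (H _ _) => [j _|j []|j []] //.
by rewrite /filter_round; case: ifP.
Qed.

(** * Sizes of inputs and the running time of the whole program *)

Lemma size_le_vsize (R : realType) (l : seq (value R)) :
  ((size l).*2 < vsize (enc_seq l))%N.
Proof.
elim: l => //= x l IH; rewrite doubleS.
have : (0 < vsize x)%N by case: x.
by lia.
Qed.

Lemma vsize_mem (R : realType) (l : seq (value R)) k : (k < size l)%N ->
  (vsize (nth VNil l k) <= vsize (enc_seq l))%N.
Proof.
elim: l k => // x l IH [_|k] /=; first by lia.
by rewrite ltnS => /IH; lia.
Qed.

Lemma size_points (R : realType) (i : instance R) :
  (2 * size (points i) < vsize (input i))%N.
Proof.
have := size_le_vsize [seq enc_vec u | u <- points i].
by rewrite size_map -mul2n /input /enc_input /=; lia.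
Qed.

(** The dimension is visible in the input only through the length of a point, so an empty sample
    gives no bound on it; the algorithm then returns [VNil]. *)
Lemma dimension_le (R : realType) (i : instance R) : points i != [::] ->
  (dimension i <= vsize (input i))%N.
Proof.
move=> p0; have p_gt0 : (0 < size (points i))%N by case: (points i) p0.
have := @vsize_mem _ [seq enc_vec u | u <- points i] 0; rewrite size_map => /(_ p_gt0).
rewrite (nth_map 0) // => le.
have := size_le_vsize [seq VNum x | x <- vec_seq (nth 0 (points i) 0)].
rewrite size_map size_vec_seq -mul2n -[enc_seq _]/(enc_vec (nth 0 (points i) 0)).
rewrite /input /enc_input [vsize (VPair _ _)]/=; lia.
Qed.

Lemma computes_estimate (R : realType) (F : prog) :
  exists g : value R -> seq (value R) -> value R,
  (forall x l y t, exec F x y t -> (t <= size l)%N -> g x l = y) /\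
  computes (fun i : instance R =>
      (size (points i) * (size (points i) + size (points i)) <= size (coins i))%N)
    (@input_size R) (fun i => rand_input (coins i) (input i))
    (fun i => if points i == [::] then VNil else enc_vec (estimate g i)).
Proof.
have [g [gP Hg]] := computes_filter_round R F; exists g; split=> //.
set D := fun i : instance R => _; set sz := @input_size R.
set a := fun i : instance R => rand_input (coins i) (input i).
have Ha D' : computes D' sz a (fun i => VPair (enc_bits R (coins i))
  (VPair (enc_nums (params i)) (VPair (VNum (threshold i)) (enc_rows (points i))))).
  exact: computes_id.
have Hr D' : computes D' sz a (fun i => enc_bits R (coins i)) := computes_fst (Ha D').
have Hpar D' : computes D' sz a (fun i => enc_nums (params i)).
  exact: computes_fst (computes_snd (Ha D')).
have Hlam D' : computes D' sz a (fun i => VNum (threshold i)).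
  exact: computes_fst (computes_snd (computes_snd (Ha D'))).
have Hp D' : computes D' sz a (fun i => enc_rows (points i)).
  exact: computes_snd (computes_snd (computes_snd (Ha D'))).
apply: (@computes_ext _ _ _ _ _ (fun i =>
    if points i != [::] then enc_vec (estimate g i) else VNil)).
  by move=> i _; case: eqP.
apply: computes_if; last exact: computes_nil.
  have := computes_prim OpIsPair (Hp D).
  by apply: computes_ext => i _ /=; case: (points i).
set D' := fun i : instance R => _.
have psz i : D' i -> (size (points i) <= sz i)%N.
  by move=> _; have := size_points i; rewrite /sz /input_size; lia.
have dsz i : D' i -> (dimension i <= sz i)%N.
  by move=> [_ /dimension_le]; rewrite /sz /input_size; lia.
have H0 : computes D' sz a (fun i => enc_vec (0 : 'rV[R]_(dimension i))).
  (* The zero vector is a point minus itself, which is where the nonemptiness in [D'] is used. *)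
  have Hx : computes D' sz a (fun i => enc_vec (nth 0 (points i) 0)).
    apply: computes_ext (computes_prim OpFst (Hp D')) => i [_].
    by case: (points i).
  apply: computes_ext (computes_vsub dsz Hx Hx) => i _.
  by rewrite subrr.
pose n (i : instance R) := size (points i).
pose st (i : instance R) k := filter_rounds g (params i) (threshold i) (coins i) (n i + n i) (coins i)
    (points i) k.
rewrite /estimate; apply: computes_lmean => //.
  by move=> i Di; apply: leq_trans (size_filter_rounds _ _ _ _ _ _ _ _) (psz i Di).
apply: (@computes_fst _ _ _ _ _ _ (fun i => enc_bits R (drop (n i * (n i + n i)) (coins i)))).
apply: (@computes_foldT _ _ _ _ _ (fun i => 'rV[R]_(dimension i)) (fun=> 0)
  (fun i => @enc_vec R (dimension i)) (@points R)
  (fun i k => VPair (enc_rows (st i k)) (enc_bits R (drop (k * (n i + n i)) (coins i))))) => //.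
  by under eq_fun do rewrite /st /= mul0n drop0; exact: computes_pair.
set D2 := fun j : instance R * nat => _.
set a2 := fun j : instance R * nat => VPair (a j.1) _.
have Hs : computes D2 (sz \o fst) a2 (fun j => VPair (enc_rows (st j.1 j.2))
    (enc_bits R (drop (j.2 * (n j.1 + n j.1)) (coins j.1)))).
  exact: computes_state.
have out x : computes D' sz a x -> computes D2 (sz \o fst) a2 (fun j => x j.1).
  exact: computes_outer.
have Hu : computes D2 (sz \o fst) a2 (fun j => VPair
   (VNum (coin_value R (take (n j.1 + n j.1) (drop (j.2 * (n j.1 + n j.1)) (coins j.1)))))
   (enc_bits R (drop (j.2.+1 * (n j.1 + n j.1)) (coins j.1)))).
  have := @computes_coin_value _ _ D2 (sz \o fst) a2
    (fun j => drop (j.2 * (n j.1 + n j.1)) (coins j.1))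
    (fun j => [seq enc_vec v | v <- points j.1]) _ _ (out _ (Hp D')) (computes_snd Hs).
  move=> H; apply: computes_ext (H _ _).
  - by move=> j _; rewrite size_map drop_drop mulSn.
  - by move=> j [Dj _]; rewrite size_map; exact: psz.
  - move=> [i k] /= [[/= Di _] /= ki]; rewrite size_map size_drop -/(n i).
    by rewrite /D -/(n i) in Di ki; nia.
apply: computes_pair; last exact: computes_snd Hu.
apply: Hg.
- by move=> j [Dj _]; exact: dsz.
- move=> j [Dj _]; apply: leq_trans (size_filter_rounds _ _ _ _ _ _ _ _) _.
  exact: psz.
- by move=> j _; exact: leq_addl.
- exact: out (Hpar D').
- exact: out (Hlam D').
- exact: out (Hr D').
- exact: computes_fst Hu.
- exact: out H0.
- exact: computes_fst Hs.
Qed.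

(** * Correctness of the stopping test *)

Lemma dotC (R : realType) d (u v : 'rV[R]_d) : dot u v = dot v u.
Proof. by apply: eq_bigr => j _; rewrite mulrC. Qed.

Lemma dotDl (R : realType) d (u v w : 'rV[R]_d) : dot (u + v) w = dot u w + dot v w.
Proof. by rewrite -big_split; apply: eq_bigr => j _; rewrite mxE mulrDl. Qed.

Lemma dotZl (R : realType) d c (u w : 'rV[R]_d) : dot (c *: u) w = c * dot u w.
Proof. by rewrite /dot mulr_sumr; apply: eq_bigr => j _; rewrite mxE mulrA. Qed.

Lemma dotDr (R : realType) d (u v w : 'rV[R]_d) : dot w (u + v) = dot w u + dot w v.
Proof. by rewrite dotC dotDl !(dotC w). Qed.

Lemma dotZr (R : realType) d c (u w : 'rV[R]_d) : dot w (c *: u) = c * dot w u.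
Proof. by rewrite dotC dotZl (dotC w). Qed.

Lemma dot0r (R : realType) d (w : 'rV[R]_d) : dot w 0 = 0.
Proof. by rewrite -(scale0r w) dotZr mul0r. Qed.

Lemma dotNr (R : realType) d (u w : 'rV[R]_d) : dot w (- u) = - dot w u.
Proof. by rewrite -scaleN1r dotZr mulN1r. Qed.

Lemma dotBr (R : realType) d (u v w : 'rV[R]_d) : dot w (u - v) = dot w u - dot w v.
Proof. by rewrite dotDr dotNr. Qed.

Lemma dot_sumr (R : realType) d (I : Type) (r : seq I) (P : pred I)
    (F : I -> 'rV[R]_d) (w : 'rV[R]_d) :
  dot w (\sum_(i <- r | P i) F i) = \sum_(i <- r | P i) dot w (F i).
Proof.
apply: (big_ind2 (fun x y => dot w x = y)) => //; first exact: dot0r.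
by move=> x1 x2 y1 y2 <- <-; rewrite dotDr.
Qed.

Lemma dot_ge0 (R : realType) d (u : 'rV[R]_d) : 0 <= dot u u.
Proof. by apply: sumr_ge0 => j _; rewrite -expr2 sqr_ge0. Qed.

Lemma dot_eq0 (R : realType) d (u : 'rV[R]_d) : dot u u = 0 -> u = 0.
Proof.
move=> u0; apply/rowP => j; rewrite mxE.
have sq i : 0 <= u 0 i * u 0 i by rewrite -expr2 sqr_ge0.
have /psumr_eq0P := u0; move=> /(_ (fun i _ => sq i)) /(_ j isT) /eqP.
by rewrite mulf_eq0 orbb => /eqP.
Qed.

Lemma l2norm_sqr (R : realType) d (u : 'rV[R]_d) : l2norm u ^+ 2 = dot u u.
Proof. by rewrite sqr_sqrtr // dot_ge0. Qed.

(** * Rank-one downdates of a multiple of the dot product *)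

Definition downdate (R : realType) d (c : R) (ys : seq 'rV[R]_d) (v w : 'rV[R]_d) : R :=
  c * dot v w - \sum_(y <- ys) dot y v * dot y w.

Lemma downdate_rcons (R : realType) d (c : R) ys y (v w : 'rV[R]_d) :
  downdate c (rcons ys y) v w = downdate c ys v w - dot y v * dot y w.
Proof. by rewrite /downdate big_rcons /= opprD addrA addrAC; ring. Qed.

Lemma downdateC (R : realType) d (c : R) ys (v w : 'rV[R]_d) :
  downdate c ys v w = downdate c ys w v.
Proof.
rewrite /downdate dotC; congr (_ - _); apply: eq_bigr => y _; exact: mulrC.
Qed.

Lemma downdateDr (R : realType) d (c : R) ys (u v w : 'rV[R]_d) :
  downdate c ys u (v + w) = downdate c ys u v + downdate c ys u w.
Proof.
rewrite /downdate dotDr; under eq_bigr do rewrite dotDr mulrDr.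
by rewrite big_split /=; ring.
Qed.

Lemma downdateZr (R : realType) d (c t : R) ys (u v : 'rV[R]_d) :
  downdate c ys u (t *: v) = t * downdate c ys u v.
Proof.
rewrite /downdate dotZr; under eq_bigr do rewrite dotZr mulrCA.
by rewrite -mulr_sumr; ring.
Qed.

Lemma downdate_sqr (R : realType) d (c t : R) ys (v z : 'rV[R]_d) :
  downdate c ys (v + t *: z) (v + t *: z) =
  downdate c ys v v + 2 * t * downdate c ys v z + t ^+ 2 * downdate c ys z z.
Proof.
rewrite downdateDr downdateZr ![downdate _ _ (_ + _) _]downdateC.
by rewrite !downdateDr !downdateZr (downdateC c ys z v); ring.
Qed.

Lemma solve_cons (R : realType) d (c : R) p L (y : 'rV[R]_d) :
  solve c (p :: L) y = solve c L y + (dot p.1 y / p.2) *: p.1.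
Proof. by rewrite /solve big_cons [X in _ + X]addrC addrA. Qed.

(** Both claims go through one induction: inversion by [solve] is the Sherman-Morrison formula,
    valid since the new pivot is non-zero, and positivity uses the vector z that represents y for
    the form built so far. *)
Lemma pivots_pass (R : realType) d (c : R) (ys : seq 'rV[R]_d) : 0 < c ->
  all (fun p => 0 < p.2) (pivots c ys) ->
  (forall y w, downdate c ys w (solve c (pivots c ys) y) = dot y w) /\
  (forall v, 0 <= downdate c ys v v).
Proof.
move=> c0; elim/last_ind: ys => [_|ys y IH].
  split=> [y w|v]; rewrite /downdate /solve !big_nil subr0.
    by rewrite addr0 dotZr dotC mulrA divff ?gt_eqF // mul1r.
  by rewrite mulr_ge0 ?dot_ge0 // ltW.
rewrite pivots_rcons /= => /andP[]; set z := solve _ _ _ => q0 /IH[Hs Hp].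
have zz w : downdate c ys w z = dot y w by exact: Hs.
split=> [x w|v].
  have yx : dot y (solve c (pivots c ys) x) = dot x z by rewrite -zz downdateC Hs.
  have pE : pivot c (pivots c ys) y = (z, 1 - dot y z) by [].
  rewrite solve_cons downdate_rcons pE.
  move: q0; rewrite [(_, _).1]/= [(_, _).2]/=; move: yx (Hs x w) (zz w).
  move: (solve _ _ x) => sx yx Hx zw q0.
  clearbody z; rewrite downdateDr downdateZr Hx zw dotDr dotZr yx (dotC z x).
  by have : 1 - dot y z != 0 by [rewrite gt_eqF|]; move=> ?; field.
(* Write B for the form before the downdate, m = y.v and s = y.z. Positivity at v - m z gives B(v,
   v) >= m^2 (2 - s) >= m^2, as s < 1. *)
rewrite downdate_rcons; have := Hp (v + (- dot y v) *: z).
rewrite downdate_sqr !zz; clearbody z; move: q0.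
by set s := dot y z; set m := dot y v => q0; nra.
Qed.

(** At the first bad pivot, s = y.z >= 1 while z still represents y, so the downdated form takes at
    z the value s - s^2 <= 0. Further downdates only lower it. *)
Lemma pivots_fail (R : realType) d (c : R) (ys : seq 'rV[R]_d) : 0 < c ->
  ~~ all (fun p => 0 < p.2) (pivots c ys) ->
  exists2 v, v != 0 & downdate c ys v v <= 0.
Proof.
move=> c0; elim/last_ind: ys => [//|ys y IH].
rewrite pivots_rcons /= negb_and.
have [ok|/IH[v v0 le] _] := boolP (all (fun p => 0 < p.2) (pivots c ys)); last first.
  by exists v => //; rewrite downdate_rcons; nra.
rewrite orbF -leNgt; set z := solve _ _ _ => q0.
have [Hs _] := pivots_pass c0 ok.
exists z.
  by apply: contraTneq q0 => ->; rewrite dot0r; lra.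
by rewrite downdate_rcons Hs -/z; nra.
Qed.

(** * Eigenvalues of a symmetric matrix from its quadratic form *)

Lemma continuous_quad (R : realType) d (A : 'M[R]_d) :
  continuous (fun v : 'rV[R]_d => dot (v *m A) v).
Proof.
have sum_cont (I : Type) (r : seq I) (h : I -> 'rV[R]_d -> R) :
    (forall i, continuous (h i)) -> continuous (fun v => \sum_(i <- r) h i v).
  move=> hc; elim: r => [|i r IH] v.
    rewrite (_ : (fun _ => _) = cst 0); first exact: cst_continuous.
    by apply/funext => w; rewrite big_nil.
  rewrite (_ : (fun _ => _) = (h i \+ (fun v => \sum_(i <- r) h i v))).
    by apply: continuousD; [exact: hc|exact: IH].
  by apply/funext => w; rewrite big_cons.
apply: (@sum_cont) => j v; apply: continuousM; last exact: coord_continuous.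
rewrite (_ : (fun _ => _) = (fun v : 'rV[R]_d => \sum_k v 0 k * A k j)).
  apply: (@sum_cont) => k w; apply: continuousM; first exact: coord_continuous.
  exact: cst_continuous.
by apply/funext => w; rewrite mxE.
Qed.

Lemma compact_sphere (R : realType) d : compact [set v : 'rV[R]_d | dot v v = 1]%classic.
Proof.
apply: bounded_closed_compact.
  exists 1; split; first exact: num_real.
  move=> M M1 v /= v1; rewrite [X in X <= M]mx_normrE.
  apply: bigmax_le; first lra.
  move=> [i j] _ /=; rewrite (ord1 i); apply: le_trans (ltW M1).
  rewrite -(@ler_pXn2r _ 2) ?nnegrE // expr1n -v1 /dot (bigD1 j) //=.
  rewrite -normrX ger0_norm ?sqr_ge0 // -expr2 lerDl.
  by apply: sumr_ge0 => k _; rewrite -expr2 sqr_ge0.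
have : closed ((fun v : 'rV[R]_d => dot (v *m 1%:M) v) @^-1` [set 1]).
  apply: closed_comp; last exact: closed_eq.
  by move=> v _; exact: continuous_quad.
by congr closed; apply/seteqP; split=> v /=; rewrite mulmx1.
Qed.

Lemma dotE (R : realType) d (u v : 'rV[R]_d) : dot u v = (u *m v^T) 0 0.
Proof. by rewrite mxE; apply: eq_bigr => j _; rewrite mxE. Qed.

Lemma dot_mulmx (R : realType) d (A : 'M[R]_d) (u v : 'rV[R]_d) :
  dot (u *m A) v = dot u (v *m A^T).
Proof. by rewrite !dotE trmx_mul trmxK mulmxA. Qed.

Lemma quad_small (R : realType) (g h : R) :
  (forall s, 2 * s * g + s ^+ 2 * h <= 0) -> g = 0.
Proof.
move=> H; apply/eqP/negPn/negP => g0.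
have g2 : 0 < g ^+ 2 by rewrite exprn_even_gt0.
have K0 : 0 < `|h| + 1 by rewrite ltr_wpDl.
(* This choice of s gives g^2 (2 (|h| + 1) + h) / (|h| + 1)^2, which is positive. *)
have := H (g / (`|h| + 1)); have := ler_norm (- h); rewrite normrN => hh.
apply/negP; rewrite -ltNge.
rewrite (_ : _ + _ = g ^+ 2 / (`|h| + 1) ^+ 2 * (2 * (`|h| + 1) + h)); last first.
  by field; rewrite gt_eqF.
have := normr_ge0 h => h0; apply: mulr_gt0; last lra.
by apply: divr_gt0 => //; exact: exprn_gt0.
Qed.

(** The quadratic form f attains its maximum on the compact unit sphere, at some x, and the maximum
    exceeds t. Along the residual w = xA - f(x) x, the inequality f <= f(x) |.|^2 has first-order
    term 2 s |w|^2, so w = 0 and x is an eigenvector. *)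
Lemma symmetric_eigenvalue (R : realType) d (A : 'M[R]_d) (t : R) (v : 'rV[R]_d) :
  A^T = A -> v != 0 -> t * dot v v < dot (v *m A) v ->
  exists2 a, eigenvalue A a & t < a.
Proof.
move=> sA v0 tv.
have vv : 0 < dot v v.
  by rewrite lt_neqAle dot_ge0 andbT eq_sym; apply: contra_neq v0 => /dot_eq0.
pose f (w : 'rV[R]_d) := dot (w *m A) w.
have fZ k w : f (k *: w) = k ^+ 2 * f w.
  by rewrite /f -scalemxAl dotZl dotZr mulrA expr2.
have unit_scale w : 0 < dot w w -> dot ((l2norm w)^-1 *: w) ((l2norm w)^-1 *: w) = 1.
  by move=> w0; rewrite dotZl dotZr mulrA -expr2 exprVn l2norm_sqr mulVf // gt_eqF.
have [||x xS xmax] := @EVT_max_rV R d f _ _ (@compact_sphere R d).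
- by exists ((l2norm v)^-1 *: v); exact: unit_scale.
- by apply: continuous_subspaceT; exact: continuous_quad.
move: xS; rewrite inE /= => x1; exists (f x).
  apply/eigenvalueP; exists x; last by apply: contra_eq_neq x1 => ->; rewrite dot0r eq_sym oner_eq0.
  have fle w : f w <= f x * dot w w.
    have [w0|w0] := eqVneq (dot w w) 0.
      by rewrite (dot_eq0 w0) /f !dot0r mulr0.
    have ww : 0 < dot w w by rewrite lt_neqAle eq_sym w0 dot_ge0.
    have := xmax ((l2norm w)^-1 *: w); rewrite inE => /(_ (unit_scale _ _ w ww)).
    by rewrite fZ exprVn l2norm_sqr mulrC ler_pdivrMr.
  apply/eqP; rewrite -subr_eq0; apply/eqP/dot_eq0.
  have E s u : f (x + s *: u) = f x + 2 * s * dot (x *m A) u + s ^+ 2 * f u.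
    rewrite /f mulmxDl -scalemxAl !(dotDl, dotDr, dotZl, dotZr).
    by rewrite [dot (u *m A) x]dot_mulmx sA [dot u _]dotC; ring.
  set w := x *m A - f x *: x.
  have ww : dot (x *m A) w = dot w w + f x * dot x w.
    by rewrite -dotZl -dotDl subrK.
  apply: (@quad_small _ _ (f w - f x * dot w w)) => s; have := fle (x + s *: w).
  clearbody w; rewrite E ww !(dotDl, dotDr, dotZl, dotZr) x1 (dotC w x).
  by move: (dot _ w) (dot x w) (f w) => ? ? ?; lra.
have := xmax ((l2norm v)^-1 *: v); rewrite inE => /(_ (unit_scale _ _ v vv)).
rewrite fZ exprVn l2norm_sqr mulrC; apply: lt_le_trans.
by rewrite ltr_pdivlMr.
Qed.

(** * The test read on the covariance matrix *)

Lemma lmean_mean (R : realType) d n (T : 'I_n -> 'rV[R]_d) (T' : {set 'I_n}) :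
  lmean [seq T i | i <- enum T'] = mean T T'.
Proof. by rewrite /lmean /mean size_map -cardE big_map big_enum. Qed.

Lemma Cov_quad (R : realType) d n (T : 'I_n -> 'rV[R]_d) (T' : {set 'I_n}) (v : 'rV[R]_d) :
  dot (v *m Cov T T') v =
  #|T'|%:R^-1 * \sum_(i in T') dot (T i - mean T T') v ^+ 2.
Proof.
rewrite /Cov -scalemxAr dotZl mulmx_sumr dotC dot_sumr; congr (_ * _).
apply: eq_bigr => i _; set y := T i - _.
rewrite mulmxA; have -> : v *m y^T *m y = dot y v *: y.
  rewrite (mx11_scalar (v *m y^T)) mul_scalar_mx -dotE dotC //.
by rewrite dotZr dotC expr2 (dotC v y).
Qed.

Lemma Cov_sym (R : realType) d n (T : 'I_n -> 'rV[R]_d) (T' : {set 'I_n}) :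
  (Cov T T')^T = Cov T T'.
Proof.
rewrite /Cov linearZ /= raddf_sum; congr (_ *: _); apply: eq_bigr => i _.
by rewrite /= trmx_mul trmxK.
Qed.

Lemma spread_test_pass (R : realType) d n lam (T : 'I_n -> 'rV[R]_d) (T' : {set 'I_n})
    (v : 'rV[R]_d) :
  0 <= lam -> spread_test lam [seq T i | i <- enum T'] ->
  \sum_(i in T') dot (T i - mean T T') v ^+ 2 <= ((1 + lam) * #|T'|%:R + 1) * dot v v.
Proof.
move=> lam0; rewrite /spread_test lmean_mean size_map -cardE => ok.
have c0 : 0 < (1 + lam) * #|T'|%:R + 1 by rewrite ltr_wpDl // mulr_ge0 ?addr_ge0.
have [_ /(_ v)] := pivots_pass c0 ok.
by rewrite /downdate subr_ge0 !big_map big_enum; under eq_bigr do rewrite -expr2.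
Qed.

Lemma spread_test_fail (R : realType) d n lam (T : 'I_n -> 'rV[R]_d) (T' : {set 'I_n}) :
  0 <= lam -> ~~ spread_test lam [seq T i | i <- enum T'] ->
  exists2 a, eigenvalue (Cov T T') a & 1 + lam < a.
Proof.
move=> lam0; rewrite /spread_test lmean_mean size_map -cardE => ko.
have c0 : 0 < (1 + lam) * #|T'|%:R + 1 by rewrite ltr_wpDl // mulr_ge0 ?addr_ge0.
have [v v0] := pivots_fail c0 ko.
rewrite /downdate subr_le0 !big_map big_enum => le.
have vv : 0 < dot v v.
  by rewrite lt_neqAle dot_ge0 andbT eq_sym; apply: contra_neq v0 => /dot_eq0.
apply: (symmetric_eigenvalue (Cov_sym T T') v0); rewrite Cov_quad.
under eq_bigr do rewrite expr2.
(* An empty sample cannot fail the test: the sum is 0 while the bound is |v|^2 > 0. *)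
have [T0|T0] := eqVneq #|T'| 0%N.
  move: le; rewrite T0 big1 ?mulr0 ?add0r ?mul1r; first by lra.
  by move=> i; rewrite (card0_eq T0).
have m0 : 0 < #|T'|%:R :> R by rewrite ltr0n lt0n.
by rewrite [X in _ < X]mulrC ltr_pdivlMr //; apply: lt_le_trans le; move: (dot v v) vv => q; nra.
Qed.

Lemma sum_sqr_le (R : realType) (I : finType) (B : {set I}) (x : I -> R) :
  (\sum_(i in B) x i) ^+ 2 <= #|B|%:R * \sum_(i in B) x i ^+ 2.
Proof.
set s := \sum_(i in B) x i.
have [B0|B0] := eqVneq #|B| 0%N.
  by rewrite B0 mul0r /s big1 ?expr0n // => i; rewrite (card0_eq B0).
have m0 : 0 < #|B|%:R :> R by rewrite ltr0n lt0n.
have : 0 <= \sum_(i in B) (#|B|%:R * x i - s) ^+ 2.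
  by apply: sumr_ge0 => i _; exact: sqr_ge0.
have -> : \sum_(i in B) (#|B|%:R * x i - s) ^+ 2 =
    #|B|%:R * (#|B|%:R * (\sum_(i in B) x i ^+ 2) - s ^+ 2).
  transitivity (\sum_(i in B) (#|B|%:R ^+ 2 * x i ^+ 2 - 2 * #|B|%:R * s * x i + s ^+ 2)).
    by apply: eq_bigr => i _; ring.
  by rewrite big_split sumrB /= sumr_const -!mulr_sumr -mulr_natl -/s; ring.
by rewrite pmulr_rge0 // subr_ge0.
Qed.

(* [g] and [b] are the numbers of good and bad points, [D] the error, [s] the
   sum of the good points in the direction of the error. *)
Lemma error_bound (R : realType) (g b D s eps delta lam : R) :
  0 < g -> b = 0 \/ 1 <= b -> b <= 10 * eps * g -> 0 < eps -> 12 * eps < 1 ->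
  6 * eps <= delta -> 0 <= lam -> s <= delta * g ->
  (g * D - s) ^+ 2 <= b * (lam * (g + b) + b + 1 +
    g * (delta ^+ 2 / (6 * eps)) + g * delta ^+ 2) ->
  D <= 5 * (delta + Num.sqrt (eps * lam)).
Proof.
move=> g0 b01 bg eps0 eps1 ed lam0 sd H.
have r0 := sqrtr_ge0 (eps * lam).
have r2 : Num.sqrt (eps * lam) ^+ 2 = eps * lam by rewrite sqr_sqrtr // mulr_ge0 // ltW.
move: (Num.sqrt _) r0 r2 => r r0 r2.
have b0 : 0 <= b by case: b01; lra.
have d0 : 0 < delta by lra.
(* After division by g^2, the squared left side is at most 20 r^2 + (50/9 + 5/3 + 5/6) delta^2, and
   the coefficient 145/18 of delta^2 is below 9. *)
have X : g * D - s <= g * (3 * delta + 5 * r).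
  apply: le_trans (ler_norm _) _.
  rewrite -(@ler_pXn2r _ 2) ?nnegrE ?normr_ge0 //; last by nra.
  rewrite real_normK ?num_real //; apply: le_trans H _.
  set K := delta ^+ 2 / (6 * eps).
  have eK : eps * K = delta ^+ 2 / 6 by rewrite /K; field; rewrite gt_eqF.
  have K0 : 0 <= K by rewrite divr_ge0 ?sqr_ge0 //; lra.
  (* The slack 1 of the test is absorbed here: b counts points, so b <= b^2. *)
  clearbody K; have b1 : b * 1 <= b * b by case: b01 => [->|]; nra.
  have bb : b <= g by nra.
  have e1 : b * (lam * (g + b) + b + 1 + g * K + g * delta ^+ 2) <=
      b * (lam * (2 * g) + 2 * b + g * K + g * delta ^+ 2).
    have : 0 <= b * (lam * (g - b)) by rewrite !mulr_ge0 //; lra.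
    by nra.
  apply: le_trans e1 _.
  have e2 : b * (lam * (2 * g) + 2 * b + g * K + g * delta ^+ 2) <=
      (10 * eps * g) * (lam * (2 * g) + 2 * (10 * eps * g) + g * K + g * delta ^+ 2).
    apply: ler_pM => //; last by rewrite !lerD2r lerD2l ler_pM2l //; lra.
    by rewrite !addr_ge0 ?mulr_ge0 ?sqr_ge0 //; lra.
  apply: le_trans e2 _.
  have -> : (10 * eps * g) * (lam * (2 * g) + 2 * (10 * eps * g) + g * K + g * delta ^+ 2)
    = g ^+ 2 * (20 * (eps * lam) + 200 * eps ^+ 2 + 10 * (eps * K) + 10 * eps * delta ^+ 2).
    by ring.
  rewrite eK -r2 exprMn ler_pM2l ?exprn_gt0 //.
  have : eps ^+ 2 <= delta ^+ 2 / 36 by nra.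
  have : eps * delta ^+ 2 <= delta ^+ 2 / 12 by have := sqr_ge0 delta; nra.
  have : 0 <= delta * r by rewrite mulr_ge0 // ltW.
  have := sqr_ge0 r; have := sqr_ge0 delta.
  by nra.
rewrite -(ler_pM2l g0).
have : 0 <= g * delta by rewrite mulr_ge0 // ltW.
nra.
Qed.

(** * Error of the estimate *)

Definition potential n (O T' : {set 'I_n}) : nat := (#|O :\: T'| + #|T' :\: O|)%N.

Lemma good_points_ge (R : realType) n (eps : R) (O T' : {set 'I_n}) :
  #|~: O|%:R <= eps * n%:R -> (potential O T')%:R <= 5 * eps * n%:R ->
  (1 - 6 * eps) * n%:R <= #|T' :&: O|%:R.
Proof.
move=> Oc; rewrite /potential natrD => pot.
have e1 : #|O|%:R = #|T' :&: O|%:R + #|O :\: T'|%:R :> R.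
  by rewrite -natrD finset.setIC -(cardsID T' O).
have e2 : n%:R = #|O|%:R + #|~: O|%:R :> R by rewrite -natrD cardsC card_ord.
have : 0 <= #|T' :\: O|%:R :> R by [].
lra.
Qed.

Lemma mean_error (R : realType) d n (eps delta lam : R) (mu : 'rV[R]_d)
    (S T : 'I_n -> 'rV[R]_d) (O T' : {set 'I_n}) :
  (0 < n)%N -> 0 < 6 * eps -> 6 * eps < 2^-1 -> 6 * eps <= delta -> 0 <= lam ->
  stable (6 * eps) delta mu S -> corrupted eps S T O ->
  (potential O T')%:R <= 5 * eps * n%:R ->
  (forall v, \sum_(i in T') dot (T i - mean T T') v ^+ 2 <=
     ((1 + lam) * #|T'|%:R + 1) * dot v v) ->
  l2norm (mean T T' - mu) <= 5 * (delta + Num.sqrt (eps * lam)).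
Proof.
move=> n0 eps0 eps1 ed lam0 stb [TS Oc] pot spread.
have gn := good_points_ge Oc pot.
have nR : 0 < n%:R :> R by rewrite ltr0n.
set w := mean T T' - mu; set D := l2norm w.
have D_ge0 : 0 <= D by exact: sqrtr_ge0.
have [D0|D0] := eqVneq D 0.
  by rewrite D0 mulr_ge0 // addr_ge0 ?sqrtr_ge0 //; lra.
have DD : D ^+ 2 = dot w w by rewrite l2norm_sqr.
pose v := D^-1 *: w.
have vw : dot v w = D by rewrite dotZl -DD expr2 mulKf.
have v1 : l2norm v = 1.
  have vv : dot v v = 1 by rewrite {2}/v dotZr vw mulVf.
  by rewrite /l2norm vv sqrtr1.
set G := T' :&: O; set B := T' :\: O.
set g : R := #|G|%:R in gn; set b : R := #|B|%:R.
have g0 : 0 < g by apply: lt_le_trans gn; rewrite mulr_gt0 //; lra.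
have mE : #|T'|%:R = g + b by rewrite -natrD cardsID.
have m0 : #|T'|%:R != 0 :> R by rewrite mE gt_eqF // ltr_wpDr.
(* Stability is applied to the surviving good points, where T and S agree. *)
have [|s1 s2] := stb v G v1; first exact: gn.
pose p i := dot v (T i - mu).
have pS i : i \in G -> dot v (S i - mu) = p i.
  by rewrite inE => /andP[_ /TS iO]; rewrite /p iO.
rewrite (eq_bigr p) in s1; last exact: pS.
rewrite (eq_bigr (fun i => p i ^+ 2)) in s2; last by move=> i /pS ->.
rewrite -/g in s1 s2.
set sg := \sum_(i in G) p i in s1; set P2 := \sum_(i in G) p i ^+ 2 in s2.
have splitT (F : 'I_n -> R) :
    \sum_(i in T') F i = \sum_(i in G) F i + \sum_(i in B) F i.
  by rewrite (big_setID O).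
(* Deviations from the empirical mean cancel, so those of the bad points sum to exactly g D - sg. *)
have sumT : \sum_(i in T') (p i - D) = 0.
  rewrite sumrB sumr_const -mulr_natl -vw /p -dot_sumr sumrB sumr_const.
  rewrite /w /mean dotBr -scaler_nat; set X := \sum_(i in T') T i.
  by rewrite !dotBr !dotZr mulrBr mulrA divff // mul1r subrr.
have sumG : \sum_(i in G) (p i - D) = sg - g * D.
  by rewrite sumrB sumr_const -mulr_natl.
have sumG2 : \sum_(i in G) (p i - D) ^+ 2 = P2 - 2 * D * sg + g * D ^+ 2.
  transitivity (\sum_(i in G) (p i ^+ 2 - 2 * D * p i + D ^+ 2)).
    by apply: eq_bigr => i _; ring.
  by rewrite big_split sumrB /= sumr_const -mulr_sumr -(mulr_natl (D ^+ 2)).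
have spreadv : \sum_(i in T') (p i - D) ^+ 2 <= (1 + lam) * (g + b) + 1.
  have := spread v; rewrite mE -l2norm_sqr v1 expr1n mulr1; apply: le_trans.
  rewrite le_eqVlt; apply/orP; left; apply/eqP; apply: eq_bigr => i _.
  by congr (_ ^+ 2); rewrite dotC -vw /p -dotBr /w opprB addrA subrK.
have CS := sum_sqr_le B (fun i => p i - D); rewrite -/b in CS.
rewrite splitT sumG in sumT; rewrite splitT sumG2 in spreadv.
move: CS sumT spreadv; set SB := \sum_(i in B) _; set SB2 := \sum_(i in B) _.
move=> CS sumT spreadv.
have {s1} s1 : `|sg| <= delta * g.
  by move: s1; rewrite normrM normfV (gtr0_norm g0) mulrC ler_pdivrMr.
move: s1; rewrite ler_norml => /andP[sg1 sg2].
set K := delta ^+ 2 / (6 * eps) in s2.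
have {}s2 : g - g * K <= P2.
  move: s2; rewrite ler_norml => /andP[+ _].
  rewrite lerBrDl mulrC ler_pdivlMr //; lra.
apply: (@error_bound R g b D sg) => //; try lra.
- by rewrite /b; case: (#|B|) => [|k]; [left|right; rewrite ler1n].
- have bp : b <= 5 * eps * n%:R.
    by apply: le_trans pot; rewrite ler_nat leq_addl.
  apply: le_trans bp _; rewrite -!mulrA.
  (* As 6 eps < 1/2, at least half of the points are surviving good ones; this turns 5 eps n into 10
     eps g. *)
  have : n%:R <= 2 * g by nra.
  by nra.
- have -> : (g * D - sg) ^+ 2 = SB ^+ 2 by congr (_ ^+ 2); lra.
  apply: le_trans CS _; rewrite -/K ler_wpM2l //.
  (* Completing the square bounds the share of the good points from below: g D^2 - 2 D sg >= g (D -
     delta)^2 - g delta^2. *)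
  have : 0 <= g * (D - delta) ^+ 2 by rewrite mulr_ge0 ?sqr_ge0 // ltW.
  have : D * sg <= D * (delta * g) by rewrite ler_wpM2l.
  by nra.
Qed.

(** * Random removals *)

(** Expectation over m fair flips, by recursion on the first one. With lists instead of tuples,
    conditioning on a prefix is the plain equation [coin_mean_cat]. *)
Fixpoint coin_mean (R : realType) (m : nat) (h : seq bool -> R) : R :=
  if m is m'.+1 then
    (coin_mean m' (fun r => h (true :: r)) + coin_mean m' (fun r => h (false :: r))) / 2
  else h [::].

Lemma coin_mean_sum (R : realType) m (h : seq bool -> R) :
  coin_mean m h = (\sum_(r : m.-tuple bool) h r) / (2 ^ m)%:R.
Proof.
elim: m h => [|m IH] h /=.
  rewrite expn0 divr1 (bigD1 [tuple]) //= big1 ?addr0 // => t; rewrite tuple0.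
  by case/eqP.
rewrite !IH expnS natrM invfM mulrA -mulrDl [RHS]mulrAC; congr (_ / _ / _).
pose cons_t (q : bool * m.-tuple bool) : m.+1.-tuple bool := [tuple of q.1 :: q.2].
rewrite (reindex cons_t) /=.
  rewrite -(pair_bigA _ (fun b (t : m.-tuple bool) => h (b :: t))) /=.
  by rewrite big_bool.
exists (fun t => (thead t, [tuple of behead t])) => [[b t] _|t _].
  by rewrite /cons_t /=; congr pair; apply/val_inj.
by rewrite /cons_t [RHS]tuple_eta.
Qed.

Lemma coin_mean_le (R : realType) m (h h' : seq bool -> R) :
  (forall r, size r = m -> h r <= h' r) -> coin_mean m h <= coin_mean m h'.
Proof.
elim: m h h' => [|m IH] h h' le /=; first exact: le.
rewrite ler_pM2r ?invr_gt0 ?ltr0n // lerD // IH // => r rm; apply: le;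
by rewrite /= rm.
Qed.

Lemma coin_meanD (R : realType) m (h h' : seq bool -> R) :
  coin_mean m (fun r => h r + h' r) = coin_mean m h + coin_mean m h'.
Proof.
elim: m h h' => //= m IH h h'.
rewrite (IH (fun r => h (true :: r))) (IH (fun r => h (false :: r))).
by rewrite -mulrDl; congr (_ / _); ring.
Qed.

Lemma coin_meanZ (R : realType) m c (h : seq bool -> R) :
  coin_mean m (fun r => c * h r) = c * coin_mean m h.
Proof.
elim: m h => //= m IH h.
by rewrite (IH (fun r => h (true :: r))) (IH (fun r => h (false :: r))); ring.
Qed.

Lemma coin_mean_cst (R : realType) m (c : R) : coin_mean m (fun=> c) = c.
Proof. by elim: m => //= m ->; field. Qed.

Lemma coin_mean_sumr (R : realType) m (I : finType) (P : {set I}) (h : I -> seq bool -> R) :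
  coin_mean m (fun r => \sum_(i in P) h i r) = \sum_(i in P) coin_mean m (h i).
Proof.
elim: m h => //= m IH h.
rewrite (IH (fun i r => h i (true :: r))) (IH (fun i r => h i (false :: r))).
by rewrite -big_split /= mulr_suml.
Qed.

Lemma coin_mean_cat (R : realType) m k (h : seq bool -> R) :
  coin_mean (m + k) h = coin_mean m (fun r => coin_mean k (fun r' => h (r ++ r'))).
Proof. by elim: m h => //= m IH h; rewrite !IH. Qed.

Lemma coin_mean_rcons (R : realType) m (h : seq bool -> R) :
  coin_mean m.+1 h =
  coin_mean m (fun r => (h (rcons r true) + h (rcons r false)) / 2).
Proof.
rewrite -addn1 coin_mean_cat; elim: m h => [|m IH] h //=.
by rewrite (IH (fun r => h (true :: r))) (IH (fun r => h (false :: r))).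
Qed.

Lemma coin_value_half (R : realType) r b :
  coin_value R (rcons r b) = (coin_value R r + (nat_of_bool b)%:R) / 2.
Proof. exact: coin_value_rcons. Qed.

(* [coin_value r] is uniform on the multiples of [2^-m] in [0, 1). *)
Lemma coin_value_lt (R : realType) m (p : R) : 0 <= p <= 1 ->
  p <= coin_mean m (fun r => (coin_value R r < p)%R%:R) <= p + 2^-1 ^+ m.
Proof.
elim: m p => [|m IH] p /andP[p0 p1].
  by rewrite /= /coin_value /= expr0; case: ltP; rewrite ?mulr1n ?mulr0n; lra.
have cv01 (r : seq bool) : (0 <= coin_value R r)%R && (coin_value R r < 1)%R.
  elim/last_ind: r => [|r b /andP[r0 r1]]; first by rewrite /coin_value /= lexx ltr01.
  by rewrite coin_value_half; apply/andP; case: b => /=; split; lra.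
(* The last flip is the leading bit of u: it decides between u < 1/2 and u >= 1/2, and the other
   flips encode 2u modulo 1. *)
rewrite coin_mean_rcons.
have [p2|p2] := leP p (1 / 2).
- have -> : @coin_mean R m (fun r => ((coin_value R (rcons r true) < p)%R%:R +
      (coin_value R (rcons r false) < p)%R%:R) / 2) =
      2^-1 * coin_mean m (fun r => (coin_value R r < 2 * p)%R%:R).
    rewrite -coin_meanZ; congr coin_mean; apply/funext => r.
    have := cv01 r; rewrite !coin_value_half => /andP[r0 r1].
    rewrite (_ : ((_ + 1) / _ < _)%R = false); last by apply/negbTE; rewrite -leNgt /=; lra.
    rewrite (_ : ((_ + 0) / _ < _)%R = (coin_value R r < 2 * p)); last first.
      by apply/idP/idP => /=; lra.
    by rewrite add0r mulrC.
  have /IH/andP[l u] : 0 <= 2 * p <= 1 by lra.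
  by rewrite exprS; move: (coin_mean _ _) l u => ? l u; lra.
- have -> : @coin_mean R m (fun r => ((coin_value R (rcons r true) < p)%R%:R +
      (coin_value R (rcons r false) < p)%R%:R) / 2) =
      2^-1 + 2^-1 * coin_mean m (fun r => (coin_value R r < 2 * p - 1)%R%:R).
    rewrite -coin_meanZ -{2}(coin_mean_cst m 2^-1) -coin_meanD; congr coin_mean; apply/funext => r.
    have := cv01 r; rewrite !coin_value_half => /andP[r0 r1].
    rewrite (_ : ((_ + 0) / _ < _)%R = true); last by rewrite /=; lra.
    rewrite (_ : ((_ + 1) / _ < _)%R = (coin_value R r < 2 * p - 1)); last first.
      by apply/idP/idP => /=; lra.
    by rewrite mulrDl addrC mul1r mulrC.
  have /IH/andP[l u] : 0 <= 2 * p - 1 <= 1 by lra.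
  by rewrite exprS; move: (coin_mean _ _) l u => ? l u; lra.
Qed.

Lemma coin_mean_prob (R : realType) m (E : seq bool -> Prop) :
  coin_prob R (fun r : m.-tuple bool => E r) = coin_mean m (fun r => `[< E r >]%:R).
Proof.
rewrite coin_mean_sum /coin_prob; congr (_ / _).
by rewrite -sum1_card natr_sum big_mkcond /=; apply: eq_bigr => r _; rewrite inE; case: ifP.
Qed.

Lemma coin_value_bounds (R : realType) (r : seq bool) :
  0 <= coin_value R r /\ coin_value R r < 1.
Proof.
elim/last_ind: r => [|r b [r0 r1]]; first by rewrite /coin_value /= lexx ltr01.
by rewrite coin_value_half; case: b => /=; split; lra.
Qed.

(** * The output of a legitimate filter as a function on the sample *)

Lemma vitem_enc_nums (R : realType) (s : seq R) k : (k < size s)%N ->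
  vitem (enc_nums s) k = VNum (nth 0 s k).
Proof.
rewrite /vitem => ks.
have -> : vtail (enc_nums s) k = enc_nums (drop k s).
  elim: k ks => [|k IH] ks; first by rewrite drop0.
  by rewrite /vtail iterS -/(vtail _ k) IH ?(ltnW ks) // (drop_nth 0) // ltnW.
by rewrite (drop_nth 0).
Qed.

(** The running maximum starts from 0, hence the positivity condition for it to be attained. *)
Lemma vmax_enc_nums (R : realType) (s : seq R) k : (k <= size s)%N ->
  [/\ 0 <= vmax (enc_nums s) k,
      forall j, (j < k)%N -> nth 0 s j <= vmax (enc_nums s) k &
      0 < vmax (enc_nums s) k -> exists2 j, (j < k)%N & nth 0 s j = vmax (enc_nums s) k].
Proof.
elim: k => [|k IH] ks /=; first by split=> //; rewrite ltxx.
have [M0 Mle Mex] := IH (ltnW ks); rewrite vitem_enc_nums //=.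
case: ltP => cmp; split.
- exact: le_trans M0 (ltW cmp).
- move=> j; rewrite ltnS leq_eqVlt => /predU1P[->//|/Mle jM].
  exact: le_trans jM (ltW cmp).
- by move=> _; exists k.
- by [].
- by move=> j; rewrite ltnS leq_eqVlt => /predU1P[->//|/Mle].
- by move=> /Mex[j jk <-]; exists j => //; apply: ltnW.
Qed.

Lemma kept_enc_nums (R : realType) (A B : Type) (x0 : B) (f : A -> R) (T : A -> B)
    (e : seq A) (a : R) :
  kept x0 (enc_nums [seq f i | i <- e]) a [seq T i | i <- e] (size e) =
  [seq T i | i <- e & ~~ (a < f i)].
Proof.
case: e => [//|i0 e']; set e := i0 :: e'.
rewrite -[e in RHS](mkseq_nth i0) /mkseq filter_map -map_comp /kept.
have -> : [seq j <- iota 0 (size e) | ~~ vgt (vitem (enc_nums [seq f i | i <- e]) j) a]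
    = [seq j <- iota 0 (size e) | preim (nth i0 e) (fun i => ~~ (a < f i)) j].
  apply: eq_in_filter => j; rewrite mem_iota leq0n add0n andTb => je.
  by rewrite vitem_enc_nums ?size_map // (nth_map i0).
apply/eq_in_map => j; rewrite mem_filter mem_iota leq0n add0n andTb => /andP[_ je].
exact: nth_map.
Qed.

Lemma enum_sub (I : finType) (A : {set I}) (P : pred I) :
  [seq i <- enum A | P i] = enum [set i in A | P i].
Proof.
rewrite /enum_mem -filter_predI; apply: eq_filter => i /=.
by rewrite !inE andbC.
Qed.

Lemma card_sum (R : realType) (I : finType) (A : {set I}) (P : pred I) :
  #|[set i in A | P i]|%:R = \sum_(i in A) (P i)%:R :> R.
Proof.
rewrite -sum1_card natr_sum big_mkcond [RHS]big_mkcond /=.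
by apply: eq_bigr => i _; rewrite inE; case: (i \in A); case: (P i).
Qed.

(** * Drift of the potential and probability of failure *)

Lemma potential_remove (R : realType) n (O T' : {set 'I_n}) (P : pred 'I_n) :
  (potential O [set i in T' | ~~ P i])%:R = (potential O T')%:R
    + \sum_(i in T' :&: O) (P i)%:R - \sum_(i in T' :\: O) (P i)%:R :> R.
Proof.
rewrite -!card_sum /potential !natrD.
set T2 := [set i in T' | ~~ P i].
have -> : #|O :\: T2|%:R = #|O :\: T'|%:R + #|[set i in T' :&: O | P i]|%:R :> R.
  rewrite -natrD -(cardsID T' (O :\: T2)) addnC; congr (_ + _)%:R.
    by apply: eq_card => i; rewrite !inE; case: (i \in T'); case: (i \in O); case: (P i).
  by apply: eq_card => i; rewrite !inE; case: (i \in T'); case: (i \in O); case: (P i).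
have -> : #|T' :\: O|%:R = #|T2 :\: O|%:R + #|[set i in T' :\: O | P i]|%:R :> R.
  rewrite -natrD -(cardsID T2 (T' :\: O)); congr (_ + _)%:R.
    by apply: eq_card => i; rewrite !inE; case: (i \in T'); case: (i \in O); case: (P i).
  by apply: eq_card => i; rewrite !inE; case: (i \in T'); case: (i \in O); case: (P i).
by ring.
Qed.

(** By linearity of expectation, a threshold shared by all points is enough. A bad point goes with
    probability at least f / M, a good one with at most f / M + 2^-m, and bad points carry at least
    half of the weight of f. *)
Lemma coin_mean_potential (R : realType) m n (O T' : {set 'I_n}) (f : 'I_n -> R) (M : R) :
  0 < M -> (forall i, i \in T' -> 0 <= f i <= M) ->
  2 * (\sum_(i in T' :&: O) f i) <= \sum_(i in T') f i ->
  @coin_mean R m (fun r => (potential O [set i in T' | ~~ (coin_value R r * M < f i)%R])%:R)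
    <= (potential O T')%:R + n%:R * 2^-1 ^+ m.
Proof.
move=> M0 fM; rewrite [X in _ <= X](big_setID O) /= => fO.
have fO' : \sum_(i in T' :&: O) f i <= \sum_(i in T' :\: O) f i by lra.
have prob i : i \in T' ->
    f i / M <= @coin_mean R m (fun r => (coin_value R r * M < f i)%R%:R) <= f i / M + 2^-1 ^+ m.
  move=> iT; have := @coin_value_lt R m (f i / M); have /andP[f0 f1] := fM i iT.
  rewrite divr_ge0 ?(ltW M0) //= ler_pdivrMr // mul1r f1 => /(_ isT).
  suff -> : (fun r => (coin_value R r < f i / M)%R%:R) =
            (fun r => (coin_value R r * M < f i)%R%:R) :> (seq bool -> R) by [].
  by apply/funext => r; rewrite ltr_pdivlMr.
rewrite (_ : (fun r => _) = (fun r => ((potential O T')%:R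
    + \sum_(i in T' :&: O) (coin_value R r * M < f i)%R%:R)
    + -1 * \sum_(i in T' :\: O) (coin_value R r * M < f i)%R%:R) :> (seq bool -> R)); last first.
  by apply/funext => r; rewrite potential_remove mulN1r.
rewrite coin_meanD coin_meanD coin_mean_cst coin_meanZ !coin_mean_sumr -addrA lerD2l.
have up : \sum_(i in T' :&: O) coin_mean m (fun r => (coin_value R r * M < f i)%R%:R)
    <= (\sum_(i in T' :&: O) f i) / M + n%:R * 2^-1 ^+ m.
  apply: (@le_trans _ _ (\sum_(i in T' :&: O) (f i / M + 2^-1 ^+ m))).
    by apply: ler_sum => i; rewrite inE => /andP[/prob/andP[_ ->]].
  rewrite big_split /= -mulr_suml lerD2l sumr_const -[X in X <= _]mulr_natl ler_wpM2r //.
  by rewrite ler_nat -[X in (_ <= X)%N](card_ord n) max_card.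
have lo : (\sum_(i in T' :\: O) f i) / M <=
    \sum_(i in T' :\: O) coin_mean m (fun r => (coin_value R r * M < f i)%R%:R).
  rewrite mulr_suml; apply: ler_sum => i; rewrite inE => /andP[_ /prob/andP[->]] //.
have : (\sum_(i in T' :&: O) f i) / M <= (\sum_(i in T' :\: O) f i) / M.
  by rewrite ler_pM2r ?invr_gt0.
by lra.
Qed.

Lemma coin_mean_le_cst (R : realType) m (h : seq bool -> R) c :
  (forall r, size r = m -> h r <= c) -> coin_mean m h <= c.
Proof. by move=> /coin_mean_le; rewrite coin_mean_cst. Qed.

(** The definition adds rounds at the end, as the program's loop does; conditioning on the first
    flips requires the first round to be split off. *)
Lemma filter_rounds_first (R : realType) g par (lam : R) d r m r' (rows : seq 'rV[R]_d) k :
  filter_rounds g par lam r m r' rows k.+1 =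
  filter_rounds g par lam r m (drop m r')
    (filter_round g par lam r rows (coin_value R (take m r'))) k.
Proof.
elim: k => [|k IH] /=; first by rewrite mul0n drop0.
rewrite -IH /= drop_drop; congr (filter_round _ _ _ _ _ (coin_value R (take m (drop _ r')))).
by rewrite mulSn addnC.
Qed.

Lemma filter_rounds_pass (R : realType) g par (lam : R) d r m r' (rows : seq 'rV[R]_d) k :
  spread_test lam rows -> filter_rounds g par lam r m r' rows k = rows.
Proof. by move=> ok; elim: k => //= k ->; rewrite /filter_round ok. Qed.

(** If no point were corrupted, T' would lie in O and the weight inequality would force f = 0. So
    eps n >= 1 once the filter has answered, which keeps the drift small relative to 5 eps n. *)
Lemma no_corruption (R : realType) n (eps : R) (O T' : {set 'I_n}) (f : 'I_n -> R) :
  #|~: O|%:R <= eps * n%:R -> (forall i, i \in T' -> 0 <= f i) ->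
  (exists2 i, i \in T' & f i != 0) ->
  2 * (\sum_(i in T' :&: O) f i) <= \sum_(i in T') f i -> 1 <= eps * n%:R.
Proof.
move=> Oc f0 [i iT fi]; rewrite [X in _ <= X](big_setID O) /= => fO.
apply: le_trans Oc; rewrite ler1n lt0n; apply: contra_neq fi => /eqP.
rewrite cards_eq0 => /eqP OC0.
have sub : T' :\: O = finset.set0.
  by apply/eqP; rewrite -finset.subset0 -OC0; apply/fintype.subsetP => j; rewrite !inE => /andP[].
move: fO; rewrite sub big_set0 addr0 => fO.
have s0 : \sum_(j in T' :&: O) f j = 0.
  apply/eqP; rewrite eq_le; apply/andP; split; first by lra.
  by apply: sumr_ge0 => j; rewrite inE => /andP[/f0].
have nonneg j : j \in T' :&: O -> 0 <= f j by rewrite inE => /andP[/f0].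
have /psumr_eq0P := s0; move=> /(_ nonneg) ->//.
rewrite inE iT /=; apply: contraT => iO.
by move: OC0 => /setP /(_ i); rewrite !inE iO.
Qed.

(** Optional stopping, as an induction on the number j of remaining rounds: the bound is trivial
    above the level 5 eps n, follows from [nBad] once the test passes, and is otherwise averaged
    over one round. The clock is a function of the flips still to come because it also contains
    those already spent; [e] counts surplus flips. *)
Lemma failure_bound (R : realType) (F : prog) g c k par (lam eps : R) d n
    (T : 'I_n -> 'rV[R]_d) (O : {set 'I_n}) (Bad : seq 'rV[R]_d -> Prop) (m K : nat) :
  (forall x l y t, exec F x y t -> (t <= size l)%N -> g x l = y) ->
  (0 < n)%N -> 0 < eps -> 6 * eps < 1 -> 0 <= lam ->
  #|~: O|%:R <= eps * n%:R ->
  good_filter F c k par lam eps T O ->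
  (forall T' : {set 'I_n}, (potential O T')%:R <= 5 * eps * n%:R ->
     spread_test lam [seq T i | i <- enum T'] -> ~ Bad [seq T i | i <- enum T']) ->
  (forall T' : {set 'I_n},
     (polybound c k (vsize (enc_input par lam [seq T i | i <- enum T'])) <= K)%N) ->
  forall j e (T' : {set 'I_n}) (clock : seq bool -> seq bool),
    (forall r, size r = (j * m + e)%N -> (K <= size (clock r))%N) ->
    (#|T'| <= j)%N ->
    @coin_mean R (j * m + e) (fun r => `[< Bad (filter_rounds g par lam (clock r) m r
       [seq T i | i <- enum T'] j) >]%:R) <=
    (potential O T')%:R / (5 * eps * n%:R) + j%:R * (n%:R * 2^-1 ^+ m) / 5.
Proof.
move=> gP n0 eps0 eps1 lam0 Oc gf nBad Kb.
have nR : 0 < n%:R :> R by rewrite ltr0n.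
have en : 0 < 5 * eps * n%:R by rewrite !mulr_gt0.
have drift_ge0 (j : nat) : 0 <= j%:R * (n%:R * 2^-1 ^+ m) / 5 :> R.
  by rewrite !mulr_ge0 ?invr_ge0 // exprn_ge0 // invr_ge0.
elim=> [|j IH] e T' clock cK T'j.
  have [big|small] := ltP (5 * eps * n%:R) (potential O T')%:R.
    apply: (@le_trans _ _ 1).
      by apply: coin_mean_le_cst => r _; rewrite lern1 leq_b1.
    by rewrite ler_wpDr ?drift_ge0 // ler_pdivlMr // mul1r ltW.
  (* With no point left, a small potential would still require (1 - 6 eps) n > 0 good points. *)
  have := good_points_ge Oc small; move: T'j; rewrite leqn0 cards_eq0 => /eqP ->.
  by rewrite finset.set0I cards0 => H; nra.
have [big|small] := ltP (5 * eps * n%:R) (potential O T')%:R.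
  apply: (@le_trans _ _ 1).
    by apply: coin_mean_le_cst => r _; rewrite lern1 leq_b1.
  by rewrite ler_wpDr ?drift_ge0 // ler_pdivlMr // mul1r ltW.
set rows := [seq T i | i <- enum T'].
have [ok|ko] := boolP (spread_test lam rows).
  apply: (@le_trans _ _ 0); last by rewrite addr_ge0 // divr_ge0 // ltW.
  apply: coin_mean_le_cst => r _; rewrite filter_rounds_pass // lern0 eqb0; apply/asboolPn.
  exact: nBad.
have [f [Ff f0 fn0 fO]] := gf T' (good_points_ge Oc small) (spread_test_fail lam0 ko).
have en1 := no_corruption Oc f0 fn0 fO.
set x := enc_input par lam rows in Ff.
set s := [seq f i | i <- enum T'] in Ff.
have gx r : size r = (j.+1 * m + e)%N -> g x (bit_values R (clock r)) = enc_nums s.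
  move=> rm; case: Ff => t Et tle; apply: gP Et _; rewrite size_map.
  exact: leq_trans tle (leq_trans (Kb T') (cK r rm)).
have ssz : size s = size rows by rewrite !size_map.
have [M0 Mge Mex] := @vmax_enc_nums R s (size rows) (eq_leq (esym ssz)).
set M := vmax (enc_nums s) (size rows) in M0 Mge Mex.
have rsz : size rows = size (enum T') by rewrite size_map.
have [i0 i0T fi0] := fn0.
have idx i : i \in T' -> (index i (enum T') < size (enum T'))%N.
  by rewrite index_mem mem_enum.
have fM i : i \in T' -> f i <= M.
  move=> iT; have := Mge (index i (enum T')).
  rewrite rsz /s (nth_map i0) ?idx // nth_index ?mem_enum //.
  exact.
have M_gt0 : 0 < M.
  apply: lt_le_trans (fM i0 i0T); rewrite lt_neqAle eq_sym fi0.
  exact: f0.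
pose T2 r := [set i in T' | ~~ (coin_value R r * M < f i)%R].
have step r : size r = (j.+1 * m + e)%N -> filter_round g par lam (clock r) rows
    (coin_value R (take m r)) = [seq T i | i <- enum (T2 (take m r))].
  move=> rm; rewrite /filter_round (negbTE ko) gx // -/M rsz.
  by rewrite kept_enc_nums enum_sub.
(* As u < 1, a point with f = M lies above the threshold u M and is removed. *)
have T2lt r : (#|T2 r| <= j)%N.
  have [j0] := Mex M_gt0; rewrite rsz => j0lt; rewrite /s (nth_map i0) // => fj0.
  rewrite -ltnS; apply: leq_trans T'j; apply: proper_card; apply/properP; split.
    by apply/fintype.subsetP => i; rewrite inE => /andP[].
  have j0T : nth i0 (enum T') j0 \in T' by rewrite -mem_enum mem_nth.
  exists (nth i0 (enum T') j0) => //; rewrite inE j0T /= negbK fj0.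
  by have [_ u1] := coin_value_bounds R r; rewrite gtr_pMl.
rewrite mulSn -addnA coin_mean_cat.
pose eta : R := j%:R * (n%:R * 2^-1 ^+ m) / 5.
apply: (@le_trans _ _ (coin_mean m (fun r =>
  (5 * eps * n%:R)^-1 * (potential O (T2 r))%:R + eta))).
  apply: coin_mean_le => r rm; rewrite [_^-1 * _]mulrC.
  apply: le_trans (IH e (T2 r) (fun r' => clock (r ++ r')) _ (T2lt r)).
    apply: coin_mean_le => r' r'm; rewrite filter_rounds_first step; last first.
      by rewrite size_cat rm r'm mulSn addnA.
    by rewrite take_size_cat // drop_size_cat.
  by move=> r' r'm; apply: cK; rewrite size_cat rm r'm mulSn addnA.
rewrite coin_meanD coin_mean_cst coin_meanZ.
have mp := @coin_mean_potential R m n O T' f M M_gt0 _ fO.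
have {}mp := mp (fun i iT => introT andP (conj (f0 i iT) (fM i iT))).
apply: (@le_trans _ _ ((5 * eps * n%:R)^-1 *
   ((potential O T')%:R + n%:R * 2^-1 ^+ m) + eta)).
  by rewrite lerD2r ler_pM2l // invr_gt0.
rewrite /eta -[j.+1%:R]natr1; set w := n%:R * _; set q := (5 * eps * n%:R)^-1.
have w0 : 0 <= w by rewrite mulr_ge0 // exprn_ge0 // invr_ge0.
(* This is where [en1] enters: 5 eps n >= 5. *)
have qw : q * w <= 5^-1 * w.
  by rewrite ler_wpM2r // lef_pV2 ?posrE // -mulrA ler_peMr.
by move: (potential O T')%:R j%:R => P J; lra.
Qed.

(** * Assembling the algorithm *)

Lemma vsize_filter (R : realType) (A : Type) (h : A -> value R) (P : pred A) (e : seq A) :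
  (vsize (enc_seq [seq h i | i <- e & P i]) <= vsize (enc_seq [seq h i | i <- e]))%N.
Proof. by elim: e => //= i e IH; case: (P i) => /=; lia. Qed.

Lemma vsize_subsample (R : realType) par (lam : R) d n (T : 'I_n -> 'rV[R]_d) (T' : {set 'I_n}) :
  (vsize (enc_input par lam [seq T i | i <- enum T']) <=
   vsize (enc_input par lam [seq T i | i <- enum 'I_n]))%N.
Proof.
rewrite /enc_input /= !ltnS !leq_add2l -!(map_comp (@enc_vec R d) T).
have -> : enum T' = [seq i <- enum 'I_n | i \in T'].
  by rewrite /enum_mem -filter_predI; apply: eq_filter => i /=; rewrite andbT.
exact: vsize_filter.
Qed.

(** The flips must suffice both as a clock for the filter, c s^k of them, and for n thresholds of 2n
    bits, at most s^2 since 2n < s. *)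
Lemma coin_count (c k s : nat) :
  (0 < s)%N -> (c * s ^ k + s * s <= polybound (c + 2) (k + 2) s)%N.
Proof.
move=> s0; rewrite /polybound mulnDl expnD mulnCA.
have k1 : (0 < s ^ k)%N by rewrite expn_gt0 s0.
have s2 : (0 < s ^ 2)%N by rewrite expn_gt0 s0.
by rewrite mulnn; nia.
Qed.

Lemma leq_expn2r m n k : (m <= n)%N -> (m ^ k <= n ^ k)%N.
Proof. by move=> mn; elim: k => // k IH; rewrite !expnS leq_mul. Qed.

Lemma running_time_bound (c0 k0 c k s t : nat) : (0 < s)%N ->
  (t <= c0 * (s + polybound (c + 2) (k + 2) s).+1 ^ k0)%N ->
  (t <= polybound (c0 * (c + 4) ^ k0) ((k + 2) * k0) s)%N.
Proof.
move=> s0 /leq_trans; apply; rewrite /polybound -mulnA leq_mul2l.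
rewrite expnM -expnMn; apply/orP; right; apply: leq_expn2r.
have k1 : (0 < s ^ k.+1)%N by rewrite expn_gt0 s0.
have -> : (s ^ (k + 2) = s * s ^ k.+1)%N by rewrite addn2 expnS.
by nia.
Qed.

(** The total drift over n rounds of 2n flips is the square of n 2^-n <= 1/2. *)
Lemma exp_drift (R : realType) n : (0 < n)%N ->
  n%:R * (n%:R * 2^-1 ^+ (n + n)) <= 4^-1 :> R.
Proof.
move=> n0; have n2 : (2 * n <= 2 ^ n)%N.
  by case: n n0 => // n _; rewrite expnS leq_mul2l ltn_expl.
have {}n2 : 2 * n%:R <= 2 ^+ n :> R by rewrite -natrX -natrM ler_nat.
have q0 : 0 <= 2^-1 ^+ n :> R by rewrite exprn_ge0 // invr_ge0.
have le : n%:R * 2^-1 ^+ n <= 2^-1 :> R.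
  rewrite exprVn ler_pdivrMr ?exprn_gt0 //; lra.
have ge : 0 <= n%:R * 2^-1 ^+ n :> R by rewrite mulr_ge0.
rewrite exprD; move: (2^-1 ^+ n) (n%:R) le ge => q m le ge.
have -> : m * (m * (q * q)) = (m * q) ^+ 2 by ring.
have -> : 4^-1 = 2^-1 ^+ 2 :> R by rewrite expr2 -invfM; congr (_^-1); ring.
by rewrite ler_pXn2r ?nnegrE.
Qed.

Theorem theorem2p12 (R : realType) :
  exists2 C : R, 0 < C &
  forall (F : prog) (c k : nat),
  exists (A : prog) (cr kr c' k' : nat),
    rand_poly_time R A cr kr c' k' /\
    forall (d n : nat) (X : probability (d.-tuple (measurableTypeR R)) R)
           (muX : 'rV[R]_d) (eps delta lam : R) (par : seq R)
           (S T : 'I_n -> 'rV[R]_d) (O : {set 'I_n}),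
      (0 < n)%N ->
      0 < 6 * eps -> 6 * eps < 2^-1 -> 6 * eps <= delta -> 0 <= lam ->
      has_mean X muX ->
      stable (6 * eps) delta muX S ->
      corrupted eps S T O ->
      good_filter F c k par lam eps T O ->
      let x := enc_input par lam [seq T i | i in 'I_n] in
      2 / 3 <= coin_prob R (fun r : (polybound cr kr (vsize x)).-tuple bool =>
        exists (muhat : 'rV[R]_d) (t : nat),
          exec A (rand_input r x) (enc_vec muhat) t /\
          l2norm (muhat - muX) <= C * (delta + Num.sqrt (eps * lam))).
Proof.
exists 5 => // F c k.
have [g [gP [A [t [[c0 [k0 tP]] HA]]]]] := computes_estimate R F.
exists A, (c + 2)%N, (k + 2)%N, (c0 * (c + 4) ^ k0)%N, ((k + 2) * k0)%N.
have enough (i : instance R) :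
    size (coins i) = polybound (c + 2) (k + 2) (vsize (input i)) ->
    (size (points i) * (size (points i) + size (points i)) <= size (coins i))%N.
  move=> ->; have := size_points i; set s := vsize _ => ns.
  have s0 : (0 < s)%N by lia.
  by have := coin_count c k s0; nia.
split.
  move=> par lam d T x r; pose i := Instance par lam T r.
  have Di := enough i (size_tuple r).
  exists (if T == [::] then VNil else enc_vec (estimate g i)).
  apply: within_le (HA i Di) _; apply: running_time_bound.
    exact: leq_ltn_trans (leq0n _) (size_points i).
  by have := tP i Di; rewrite /input_size size_tuple.
move=> d n X muX eps delta lam par S T O n0 eps0 eps1 ed lam0 _ stb cor gf.
cbv zeta; set x := enc_input par lam _.
set M := polybound _ _ _.
pose Bad (rows : seq 'rV[R]_d) :=
  ~ l2norm (lmean rows - muX) <= 5 * (delta + Num.sqrt (eps * lam)).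
pose rows := [seq T i | i <- enum 'I_n].
have rsz : size rows = n by rewrite size_map size_enum_ord.
pose fr (r : seq bool) := filter_rounds g par lam r (n + n) r rows n.
pose E (r : seq bool) := exists (muhat : 'rV[R]_d) (t : nat),
  exec A (rand_input r x) (enc_vec muhat) t /\
  l2norm (muhat - muX) <= 5 * (delta + Num.sqrt (eps * lam)).
rewrite (coin_mean_prob R M E).
have xsz : (2 * n < vsize x)%N.
  by have := size_points (Instance par lam rows [::]); rewrite /= rsz.
have s0 : (0 < vsize x)%N by lia.
have Mn : (n * (n + n) <= M)%N by have := coin_count c k s0; rewrite -/M; nia.
(* Every sequence of flips satisfies [E] or [Bad], so a failure probability of 1/4 leaves 3/4 for
   success. *)
have EBad r : size r = M -> 1 <= `[< E r >]%:R + `[< Bad (fr r) >]%:R :> R.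
  move=> rM; case: (asboolP (Bad (fr r))) => [_|nB].
    by rewrite lerDr ler0n.
  rewrite addr0; suff -> : `[< E r >] = true by [].
  apply/asboolP; pose i := Instance par lam rows r.
  have [u Eu _] := HA i (enough i rM).
  exists (estimate g i), u; split.
    suff -> : enc_vec (estimate g i) =
      (if points i == [::] then VNil else enc_vec (estimate g i)) by [].
    by case: eqP => // r0; move: rsz n0; rewrite -[rows]/(points i) r0 => <-.
  by move/contrapT: nB; rewrite /fr /estimate /= rsz.
have rowsE : rows = [seq T i | i <- enum [set: 'I_n]].
  by rewrite /rows (@eq_enum _ 'I_n [set: 'I_n]) // => i; rewrite !inE.
have eps0' : 0 < eps by lra.
have nR : 0 < n%:R :> R by rewrite ltr0n.
(* The initial potential, at most eps n, contributes 1/5 and the drift at most 1/20. *)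
have fail : coin_mean M (fun r => `[< Bad (fr r) >]%:R) <= 4^-1 :> R.
  have -> : M = (n * (n + n) + (M - n * (n + n)))%N by rewrite subnKC.
  rewrite /fr rowsE; apply: le_trans (@failure_bound R F g c k par lam eps d n T O
    Bad (n + n) (c * vsize x ^ k) gP n0 eps0' _ lam0 cor.2 gf _ _ n _ [set: 'I_n] id _ _) _.
  - by lra.
  - move=> T' pot ok; rewrite /Bad lmean_mean => nP; apply: nP.
    apply: (mean_error n0 eps0 eps1 ed lam0 stb cor pot) => v.
    exact: spread_test_pass.
  - by move=> T'; rewrite leq_mul2l leq_expn2r ?orbT //; exact: vsize_subsample.
  - move=> r ->; rewrite subnKC //.
    by have := coin_count c k s0; rewrite -/M; lia.
  - by rewrite cardsT card_ord.
  have -> : potential O [set: 'I_n] = #|~: O|.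
    by rewrite /potential finset.setDT cards0 add0n finset.setTD.
  have p1 : #|~: O|%:R / (5 * eps * n%:R) <= 5^-1.
    rewrite ler_pdivrMr ?mulr_gt0 //; have := cor.2.
    by move: (_%:R) => q; lra.
  by have := exp_drift R n0; lra.
have : 1 <= coin_mean M (fun r => `[< E r >]%:R) + coin_mean M (fun r => `[< Bad (fr r) >]%:R) :> R.
  by rewrite -coin_meanD -[X in X <= _](coin_mean_cst M); exact: coin_mean_le.
by lra.
Qed.
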